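(* Let $\Bbbk[\mathbf z]=\Bbbk[z_1,\dots,z_m]$ be positively $\mathbb Z^d$-graded, with ordinary weights $\mathbf a_1,\dots,\mathbf a_m$. The multidegree of any finitely generated $\mathbb Z^d$-graded module of dimension $m-r$ over $\Bbbk[\mathbf z]$ is a positive sum of terms of the form $\mathbf a_{i_1}\cdots\mathbf a_{i_r}\in\mathrm{Sym}^r_{\mathbb Z}(\mathbb Z^d)$, where $i_1<\cdots<i_r$.
   Context: $\Bbbk$ is an arbitrary field. The variable $z_i$ has degree $\mathbf a_i=(a_{i1},\dots,a_{id})\in\mathbb Z^d$; its ordinary weight is the linear form $\mathbf a_i=a_{i1}t_1+\cdots+a_{id}t_d$ in $\mathbb Z[\mathbf t]=\mathbb Z[t_1,\dots,t_d]=\mathrm{Sym}^\bullet_{\mathbb Z}(\mathbb Z^d)$. The grading is positive if every graded piece of $\Bbbk[\mathbf z]$ is finite dimensional over $\Bbbk$ (equivalently, all $\mathbf a_i$ lie in a single open half-space). $K$-polynomial and multidegree: a finitely generated $\mathbb Z^d$-graded module $\Gamma$ has a finite graded free resolution with $i$-th term $\bigoplus_j\Bbbk[\mathbf z](-\mathbf b_{ij})$ (the $j$-th summand generated in degree $\mathbf b_{ij}$), and $\mathcal K(\Gamma;\mathbf t)=\sum_i(-1)^i\sum_j\mathbf t^{\mathbf b_{ij}}$. The power series $\mathcal K(\Gamma;\mathbf 1-\mathbf t)$ is obtained by substituting $1-t_j$ for every $t_j$ and expanding every $(1-t_j)^a$, $a\in\mathbb Z$, as a power series. The multidegree $\mathcal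 C(\Gamma;\mathbf t)\in\mathbb Z[\mathbf t]$ is the sum of the lowest (total) degree terms of $\mathcal K(\Gamma;\mathbf 1-\mathbf t)$. ''Positive sum'' means a sum with nonnegative integer coefficients which, in particular, is nonzero. *)

(* Defs.v *)
From HB Require Import structures.
From mathcomp Require Import all_boot all_order all_algebra.
From mathcomp Require Import ring_quotient.
From mathcomp.multinomials Require Import freeg mpoly.
From Stdlib Require Import ClassicalEpsilon.

Set Implicit Arguments.
Unset Strict Implicit.
Unset Printing Implicit Defensive.

Import GRing.Theory.
Local Open Scope ring_scope.

Definition wdeg (m d : nat) (a : 'I_m -> 'rV[int]_d) (u : 'X_{1..m}) :
    'rV[int]_d :=
  \sum_i a i *+ u i.

Definition homogeneous_poly (k : fieldType) (m d : nat) (a : 'I_m -> 'rV[int]_d)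
    (b : 'rV[int]_d) (p : {mpoly k[m]}) : Prop :=
  forall u, u \in msupp p -> wdeg a u = b.

(* Every graded piece is contained in the k-span of a finite family. *)
Definition positively_graded (k : fieldType) (m d : nat)
    (a : 'I_m -> 'rV[int]_d) : Prop :=
  forall b, exists s : seq {mpoly k[m]}, forall p, homogeneous_poly a b p ->
    exists c : 'I_(size s) -> k, p = \sum_i c i *: s`_i.

Record grading (k : fieldType) (m d : nat) (a : 'I_m -> 'rV[int]_d)
    (M : lmodType {mpoly k[m]}) := Grading {
  gpart :> 'rV[int]_d -> M -> Prop;
  gpart0 : forall b, gpart b 0;
  gpartB : forall b v w, gpart b v -> gpart b w -> gpart b (v - w);
  gpartZ : forall b c p v, homogeneous_poly a b p -> gpart c v ->
    gpart (b + c) (p *: v);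
  gpart_span : forall v, exists (s : seq 'rV[int]_d) (w : 'rV[int]_d -> M),
    (forall b, gpart b (w b)) /\ v = \sum_(b <- s) w b;
  gpart_direct : forall (s : seq 'rV[int]_d) (w : 'rV[int]_d -> M),
    uniq s -> (forall b, gpart b (w b)) -> \sum_(b <- s) w b = 0 ->
    forall b, b \in s -> w b = 0
}.

Definition finitely_generated (R : nzRingType) (M : lmodType R) : Prop :=
  exists s : seq M, forall v,
    exists c : 'I_(size s) -> R, v = \sum_i c i *: s`_i.

Definition annihilates (R : nzRingType) (M : lmodType R) (f : R) : Prop :=
  forall v : M, f *: v = 0.

(* P_0 < ... < P_n are prime ideals containing Ann M; properness of each P_i
   is part of idealr_closed. *)
Definition prime_chain (R : comNzRingType) (M : lmodType R) (n : nat)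
    (P : 'I_n.+1 -> {pred R}) : Prop :=
  (forall i, [/\ idealr_closed (P i), prime_idealr_closed (P i)
               & forall f, annihilates M f -> f \in P i]) /\
  (forall i j : 'I_n.+1, (i < j)%N ->
     {subset P i <= P j} /\ ~ {subset P j <= P i}).

(* The Krull dimension of R / Ann M is n; no n qualifies when M = 0. *)
Definition module_dim (R : comNzRingType) (M : lmodType R) (n : nat) : Prop :=
  (exists P : 'I_n.+1 -> {pred R}, prime_chain M P) /\
  (forall n' (P : 'I_n'.+1 -> {pred R}), prime_chain M P -> (n' <= n)%N).

(* Degree c part of the free module \bigoplus_j k[z](-b_j), whose j-th basis
   vector has degree b_j. *)
Definition free_homog (k : fieldType) (m d : nat) (a : 'I_m -> 'rV[int]_d)
    (n : nat) (b : 'I_n -> 'rV[int]_d) (c : 'rV[int]_d)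
    (v : 'rV[{mpoly k[m]}]_n) : Prop :=
  forall j, homogeneous_poly a (c - b j) (v 0 j).

Record free_resolution (k : fieldType) (m d : nat) (a : 'I_m -> 'rV[int]_d)
    (M : lmodType {mpoly k[m]}) (G : grading a M) := FreeResolution {
  res_len : nat;
  res_rank : nat -> nat;
  res_shift : forall i, 'I_(res_rank i) -> 'rV[int]_d;
  res_diff : forall i, {linear 'rV[{mpoly k[m]}]_(res_rank i.+1) ->
                               'rV[{mpoly k[m]}]_(res_rank i)};
  res_aug : {linear 'rV[{mpoly k[m]}]_(res_rank 0) -> M};
  res_finite : forall i, (res_len < i)%N -> res_rank i = 0%N;
  res_diff_homog : forall i c v, free_homog a (@res_shift i.+1) c v ->
    free_homog a (@res_shift i) c (res_diff i v);
  res_aug_homog : forall c v, free_homog a (@res_shift 0) c v ->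
    G c (res_aug v);
  res_aug_surj : forall x, exists v, res_aug v = x;
  res_exact0 : forall v, res_aug v = 0 <-> exists w, res_diff 0 w = v;
  res_exact : forall i v,
    res_diff i v = 0 <-> exists w, res_diff i.+1 w = v
}.

(* Laurent polynomials in t_1, ..., t_d as elements of the free abelian group
   on the exponents: << b >> is t^b. *)
Definition Kpoly (k : fieldType) (m d : nat) (a : 'I_m -> 'rV[int]_d)
    (M : lmodType {mpoly k[m]}) (G : grading a M) (F : free_resolution G) :
    {freeg 'rV[int]_d / int} :=
  \sum_(i < (res_len F).+1)
    \sum_(j < res_rank F i) << (-1) ^+ i *g res_shift (f := F) j >>.

(* Coefficient of t^n in the power series (1 - t)^e; Negz q is - (q + 1). *)
Definition pow1B_coef (e : int) (n : nat) : int :=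
  match e with
  | Posz q => (-1) ^+ n * 'C(q, n)%:Z
  | Negz q => 'C(q + n, n)%:Z
  end.

(* Coefficient of t^u in K(1 - t). *)
Definition subst1B_coef (d : nat) (K : {freeg 'rV[int]_d / int})
    (u : 'X_{1..d}) : int :=
  \sum_(b <- dom K) coeff b K * \prod_(j < d) pow1B_coef (b 0 j) (u j).

Definition subst1B_part (d : nat) (K : {freeg 'rV[int]_d / int}) (e : nat) :
    {mpoly int[d]} :=
  \sum_(u : 'X_{1..d < e.+1} | mdeg u == e) subst1B_coef K u *: 'X_[u].

(* The nonzero homogeneous part of K(1 - t) of least total degree, and 0 if
   K(1 - t) = 0. *)
Definition lowest_part (d : nat) (K : {freeg 'rV[int]_d / int}) :
    {mpoly int[d]} :=
  match excluded_middle_informative (exists e, subst1B_part K e != 0) with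
  | left ex => subst1B_part K (ex_minn ex)
  | right _ => 0
  end.

Definition multidegree (k : fieldType) (m d : nat) (a : 'I_m -> 'rV[int]_d)
    (M : lmodType {mpoly k[m]}) (G : grading a M) (F : free_resolution G) :
    {mpoly int[d]} :=
  lowest_part (Kpoly F).

Definition ordinary_weight (d : nat) (b : 'rV[int]_d) : {mpoly int[d]} :=
  \sum_(j < d) b 0 j *: 'X_j.

(* Main.v *)
(* The K-polynomial is determined by the Hilbert function of [M = F_0 / N]: their
   generating functions differ by the factor [\prod_i (1 - t^(a i))], and the Euler
   characteristic of the resolution computes the Hilbert function. Passing to
   leading terms, the Hilbert function counts standard monomials: [N] is filtered
   by its coordinate ideals [I_j], and the standard monomials of each [I_j] form a
   disjoint union of boxes [v + N^S]. Hence [K] is a sum of terms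
   [t^b \prod_(i notin S) (1 - t^(a i))], one for each box, and substituting [1 - t]
   the lowest term of such a summand is [\prod_(i notin S) a_i], of degree [m - #|S|].
   The lowest degree is thus [m - D] with [D] the largest [#|S|]; there is no
   cancellation, as the [a_i] are positive on some common vector.

   It remains to see that [D] is the Krull dimension. A chain of [n] strict
   inclusions of primes above some [I_j] produces [N^n] polynomials of weight [O(N)]
   that are independent modulo [I_j], so [n <= D] by growth. Conversely a box
   [v + N^S] of standard monomials of [I_j] shows that [I_j] meets [k[z_S]] trivially;
   a graded ideal [P] containing [I_j] and maximal with this property is prime, and,
   again by growth, [P + (z_i)] with [i] in [S] meets some [k[z_S']] trivially, where
   [#|S'| = #|S| - 1]. Iterating yields a chain of length [#|S|]. *)

From HB Require Import structures.
Require Import Defs.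
From mathcomp Require Import all_boot all_order all_algebra.
From mathcomp Require Import ring_quotient zify ring.
From mathcomp.multinomials Require Import freeg mpoly.
From Stdlib Require Import ClassicalEpsilon.

Set Implicit Arguments.
Unset Strict Implicit.
Unset Printing Implicit Defensive.

Import Order.TTheory GRing.Theory Num.Theory.
Local Open Scope ring_scope.

(** * Linear algebra modulo a subspace *)

Section LinearAlgebra.

Variables (k : fieldType) (R : nzRingType) (f : {rmorphism k -> R}).
Variable V : lmodType R.
Implicit Types A B C : V -> Prop.

(** Scalars act through [f], so the same notions serve polynomials over [k] ([f] the identity) and
    vectors of polynomials ([f] the embedding of constants). *)
Definition ksubspace B : Prop :=
  B 0 /\ forall c u v, B u -> B v -> B (f c *: u + v).

Definition lincomb (I : Type) (s : seq I) (e : I -> V) (c : I -> k) : V :=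
  \sum_(x <- s) f (c x) *: e x.

Definition indep B (I : eqType) (s : seq I) (e : I -> V) : Prop :=
  forall c, B (lincomb s e c) -> {in s, forall x, c x = 0}.

Definition spans A B (I : eqType) (s : seq I) (e : I -> V) : Prop :=
  forall v, A v -> exists c, B (v - lincomb s e c).

Lemma ksubspaceD B u v : ksubspace B -> B u -> B v -> B (u + v).
Proof. by case=> _ h hu hv; rewrite -[u]scale1r -(rmorph1 f); apply: h. Qed.

Lemma ksubspaceZ B c u : ksubspace B -> B u -> B (f c *: u).
Proof. by case=> h0 h hu; rewrite -[_ *: _]addr0; apply: h. Qed.

Lemma ksubspaceN B u : ksubspace B -> B u -> B (- u).
Proof.
by move=> hB hu; rewrite -scaleN1r -(rmorphN1 f); apply: ksubspaceZ.
Qed.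

Lemma ksubspaceB B u v : ksubspace B -> B u -> B v -> B (u - v).
Proof. by move=> hB hu hv; apply: ksubspaceD => //; apply: ksubspaceN. Qed.

Lemma ksubspace_sum B (I : eqType) (s : seq I) (F : I -> V) :
  ksubspace B -> {in s, forall x, B (F x)} -> B (\sum_(x <- s) F x).
Proof.
move=> hB; elim: s => [|x s IH] h; first by rewrite big_nil; case: hB.
rewrite big_cons; apply: ksubspaceD => //; first by apply: h; rewrite mem_head.
by apply: IH => y ys; apply: h; rewrite in_cons ys orbT.
Qed.

Lemma ksubspace_lincomb B (I : eqType) (s : seq I) (e : I -> V) c :
  ksubspace B -> {in s, forall x, B (e x)} -> B (lincomb s e c).
Proof.
by move=> hB h; apply: ksubspace_sum => // x xs; apply: ksubspaceZ => //; apply: h.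
Qed.

Lemma lincombZ (I : Type) (s : seq I) (e : I -> V) a c :
  f a *: lincomb s e c = lincomb s e (fun x => a * c x).
Proof.
by rewrite scaler_sumr; apply: eq_bigr => x _; rewrite scalerA rmorphM.
Qed.

Lemma extend_tnth (T : Type) (I : eqType) (s : seq I) (g : 'I_(size s) -> T) (t : T) :
  uniq s -> exists c, forall i, c (tnth (in_tuple s) i) = g i.
Proof.
move=> us; exists (fun x => if insub (index x s) is Some i then g i else t) => i.
have -> : index (tnth (in_tuple s) i) s = i.
  by rewrite (tnth_nth (tnth (in_tuple s) i)) index_uniq.
by rewrite valK.
Qed.

(** Writing the [e x] through [e'] modulo [B] gives a matrix; if it had more rows than columns, a
    nonzero vector of its left kernel would be a relation modulo [B]. *)
Lemma indep_leq_spans A B (I J : eqType) (s : seq I) (e : I -> V)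
    (s' : seq J) (e' : J -> V) :
  ksubspace B -> uniq s -> {in s, forall x, A (e x)} -> indep B s e ->
  spans A B s' e' -> (size s <= size s')%N.
Proof.
move=> hB us hA hi hs; rewrite leqNgt; apply/negP => lt_s's.
have /fin_all_exists [C hC] : forall i : 'I_(size s), exists c : J -> k,
    B (e (tnth (in_tuple s) i) - lincomb s' e' c).
  by move=> i; apply: hs; apply: hA; apply: mem_tnth.
pose M := \matrix_(i < size s, j < size s') C i (tnth (in_tuple s') j).
have : kermx M != 0.
  rewrite -mxrank_eq0 mxrank_ker -lt0n subn_gt0.
  exact: leq_ltn_trans (rank_leq_col _) lt_s's.
case/rowV0Pn => u /sub_kermxP uM u0.
have [c hc] := extend_tnth (u 0) 0 us.
have : B (lincomb s e c).
  rewrite /lincomb big_tnth.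
  have -> : \sum_(i < size s) f (c (tnth (in_tuple s) i)) *: e (tnth (in_tuple s) i)
     = \sum_(i < size s) f (u 0 i) *:
         (e (tnth (in_tuple s) i) - lincomb s' e' (C i)).
    apply/eqP; rewrite -subr_eq0 -sumrB; apply/eqP.
    transitivity (\sum_(i < size s) \sum_(j < size s')
        f (u 0 i * M i j) *: e' (tnth (in_tuple s') j)).
      apply: eq_bigr => i _; rewrite hc scalerBr opprB addrCA subrr addr0.
      rewrite lincombZ /lincomb big_tnth; apply: eq_bigr => j _.
      by rewrite mxE.
    rewrite exchange_big big1 //= => j _.
    rewrite -scaler_suml -rmorph_sum /=.
    have := congr1 (fun N : 'rV_ _ => N 0 j) uM; rewrite !mxE => ->.
    by rewrite rmorph0 scale0r.
  apply: ksubspace_sum => // i _; exact: ksubspaceZ.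
move/hi => h; case/negP: u0; apply/eqP/rowP => i; rewrite mxE -hc; apply: h.
exact: mem_tnth.
Qed.

(** For subspaces, the dimension of [A] modulo its intersection with [B]. As [B] may exceed [A], a
    whole submodule can stand for its part of one degree. *)
Definition qdim A B (n : nat) : Prop :=
  exists (I : eqType) (s : seq I) (e : I -> V),
    [/\ uniq s, size s = n, {in s, forall x, A (e x)}, indep B s e
      & spans A B s e].

Lemma qdim_unique A B n n' : ksubspace B -> qdim A B n -> qdim A B n' -> n = n'.
Proof.
move=> hB [I [s [e [us <- hA hi hs]]]] [J [s' [e' [us' <- hA' hi' hs']]]].
by apply/eqP; rewrite eqn_leq (indep_leq_spans hB us hA hi hs')
  (indep_leq_spans hB us' hA' hi' hs).
Qed.

Lemma qdimD A B C n n' : ksubspace A -> ksubspace B -> ksubspace C ->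
  (forall v, C v -> B v) -> (forall v, B v -> A v) ->
  qdim A B n -> qdim B C n' -> qdim A C (n + n').
Proof.
move=> kA kB kC CB BA [I [s [e [us <- hA hi hs]]]] [J [s' [e' [us' <- hB hi' hs']]]].
pose t : seq (I + J) := map inl s ++ map inr s'.
pose E (x : I + J) := match x with inl y => e y | inr y => e' y end.
have lE c : lincomb t E c = lincomb s e (c \o inl) + lincomb s' e' (c \o inr).
  by rewrite /lincomb big_cat !big_map.
exists (I + J)%type, t, E; split.
- rewrite cat_uniq !map_inj_uniq ?us ?us' ?andbT /=; first last.
  + by move=> ? ? [].
  + by move=> ? ? [].
  by apply/hasPn => _ /mapP [y _ ->]; apply/mapP => -[].
- by rewrite size_cat !size_map.
- move=> x; rewrite mem_cat => /orP [] /mapP [y ys ->] /=; first exact: hA.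
  by apply: BA; apply: hB.
- move=> c; rewrite lE => hc.
  have h1 : {in s, forall x, c (inl x) = 0}.
    apply: (hi (c \o inl)).
    rewrite -[lincomb _ _ _](addrK (lincomb s' e' (c \o inr))).
    by apply: ksubspaceB (CB _ hc) _ => //; apply: ksubspace_lincomb.
  have h2 : {in s', forall x, c (inr x) = 0}.
    apply: (hi' (c \o inr)); move: hc; rewrite {1}/lincomb big_seq big1 ?add0r //.
    by move=> x xs; rewrite /= h1 // rmorph0 scale0r.
  by move=> x; rewrite mem_cat => /orP [] /mapP [y ys ->]; [apply: h1|apply: h2].
- move=> v /hs [c hc]; have [c' hc'] := hs' _ hc.
  exists (fun x => match x with inl y => c y | inr y => c' y end).
  by rewrite lE opprD addrA.
Qed.

End LinearAlgebra.

(** * Sets of monomials *)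

Section MonomialSets.

Variable m : nat.
Implicit Types (u v : 'X_{1..m}) (S V : {set 'I_m}).

(* [u] belongs to [v + N^S]. *)
Definition box v S u : bool :=
  [forall i, if i \in S then (v i <= u i)%N else u i == v i].

Lemma boxP v S u :
  reflect (forall i, if i \in S then (v i <= u i)%N else u i == v i) (box v S u).
Proof. exact: forallP. Qed.

Lemma box_refl v S : box v S v.
Proof. by apply/boxP => i; case: ifP. Qed.

Lemma box_lem v S u : box v S u -> (v <= u)%MM.
Proof.
by move/boxP => h; apply/mnm_lepP => i; have := h i; case: ifP => // _ /eqP ->.
Qed.

(** Either coordinate [i] equals [v i] or it exceeds it. As an equality of numbers, this can be
    summed over lists of monomials. *)
Lemma box_split v S i u : i \in S ->
  (box v S u : nat) = (box v (S :\ i) u + box (v + U_(i))%MM S u)%N.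
Proof.
move=> iS.
have h1 : box v (S :\ i) u = (u i == v i) && box v S u.
  apply/boxP/andP => [h|[/eqP ui /boxP h] j].
    split; first by have := h i; rewrite !inE eqxx.
    apply/boxP => j; have := h j; rewrite !inE; case: (j =P i) => [->|_] //=.
    by rewrite iS => /eqP ->.
  by have := h j; rewrite !inE; case: (j =P i) => [->|_] //=; rewrite ui eqxx.
have h2 : box (v + U_(i))%MM S u = (u i != v i) && box v S u.
  apply/boxP/andP => [h|[ui /boxP h] j].
    split; first by have := h i; rewrite iS mnmDE mnm1E eqxx addn1; case: ltngtP.
    apply/boxP => j; have := h j; rewrite mnmDE mnm1E; case: ifP => // jS.
      by apply: leq_trans; rewrite leq_addr.
    by case: (i =P j) => [ij|_]; [rewrite -ij iS in jS | rewrite addn0].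
  have := h j; rewrite mnmDE mnm1E; case: ifP => jS; last first.
    by case: (i =P j) => [ij|_]; [rewrite -ij iS in jS | rewrite addn0].
  case: (i =P j) => [<-|_]; last by rewrite addn0.
  by rewrite addn1 ltn_neqAle eq_sym ui.
by rewrite h1 h2; case: (u i == v i); case: (box v S u).
Qed.

(* A point of [v + N^S] outside of [D] confines the rest of [D] to slices
   with one direction less. *)
Lemma box_ind (D : 'X_{1..m} -> Prop) (P : 'X_{1..m} -> {set 'I_m} -> Prop) :
  (forall v S, (forall u, box v S u -> D u) -> P v S) ->
  (forall v S, ~ D v -> P v S) ->
  (forall v S i, i \in S -> P v (S :\ i) -> P (v + U_(i))%MM S -> P v S) ->
  forall v S, P v S.
Proof.
move=> h1 h2 h3 v S; have [n] := ubnP #|S|; elim: n S v => // n IH S v szS.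
have [hD|] := excluded_middle_informative (forall u, box v S u -> D u).
  exact: h1.
move=> /(not_all_ex_not _ _) [u h]; have [vu uD] := imply_to_and _ _ h.
(* Inner induction on the distance from [v] to [u]: cutting along a direction in which they differ
   leaves a slice with fewer directions and a box that still contains [u] but starts nearer to
   it. *)
have [q] := ubnP (mdeg (u - v)%MM); elim: q v vu {h} => // q IHq v vu szu.
have [uv|uv] := eqVneq u v; first by apply: h2; rewrite -uv.
have [i hi] : exists i, v i != u i.
  apply/existsP; rewrite -negb_forall; apply: contraNN uv => /forallP h.
  by apply/eqP/mnmP => i; apply/esym/eqP.
have iS : i \in S.
  by have /boxP/(_ i) := vu; case: ifP => // _ /eqP e; rewrite e eqxx in hi.
have vui : box (v + U_(i))%MM S u.
  have := box_split v u iS; rewrite vu; case: (box _ (S :\ i) u) /boxP => [/(_ i)|_].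
    by rewrite !inE eqxx /= eq_sym (negbTE hi).
  by case: (box _ S u).
apply: (h3 _ _ i iS).
  by apply: IH; move: szS; rewrite (cardsD1 i) iS.
apply: IHq => //; rewrite -ltnS (leq_trans _ szu) // ltnS.
have -> : (u - v = (u - (v + U_(i))) + U_(i))%MM.
  apply/mnmP => j; have /mnm_lepP/(_ j) := box_lem vui.
  rewrite !(mnmBE, mnmDE, mnm1E); lia.
by rewrite mdegD mdeg1 addn1.
Qed.

Definition down_closed (D : pred 'X_{1..m}) : Prop :=
  forall u v, D (u + v)%MM -> D u.

(** The count says at once that the boxes lie in [D], cover it and are disjoint. By down-closure, a
    box whose corner is outside [D] misses [D] entirely. *)
Lemma stanley_decomposition (D : pred 'X_{1..m}) : down_closed D ->
  exists L : seq ('X_{1..m} * {set 'I_m}),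
    forall u, count (fun x => box x.1 x.2 u) L = D u.
Proof.
move=> hD.
suff [L hL] : exists L : seq ('X_{1..m} * {set 'I_m}),
    forall u, count (fun x => box x.1 x.2 u) L = box 0%MM setT u && D u.
  exists L => u; rewrite hL; case: boxP => // -[] i.
  by rewrite inE mnm0E.
apply: (@box_ind D (fun v S => exists L : seq ('X_{1..m} * {set 'I_m}),
  forall u, count (fun x => box x.1 x.2 u) L = box v S u && D u)).
- move=> v S h; exists [:: (v, S)] => u /=; rewrite addn0.
  by case: (boolP (box v S u)) => //= /h ->.
- move=> v S h; exists [::] => u /=; case: (boolP (box v S u)) => //= vu.
  case: (boolP (D u)) => // Du; case: h; apply: (hD _ (u - v)%MM).
  by rewrite addmC submK //; exact: box_lem vu.
- move=> v S i iS [L1 hL1] [L2 hL2]; exists (L1 ++ L2) => u.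
  rewrite count_cat hL1 hL2; have := box_split v u iS.
  by case: (D u); rewrite ?andbT ?andbF.
Qed.

Lemma box_sub_of_count (D : pred 'X_{1..m}) (L : seq ('X_{1..m} * {set 'I_m})) x u :
  (forall u, count (fun x => box x.1 x.2 u) L = D u) -> x \in L ->
  box x.1 x.2 u -> D u.
Proof.
move=> hL xL xu; apply: contraT => Du; have := hL u; rewrite (negbTE Du) => /eqP.
by rewrite eqn0Ngt -has_count => /hasPn /(_ x xL); rewrite xu.
Qed.

(** A form of Dickson's lemma: in [box_ind] for the complement of [U], a box with its corner in [U]
    needs only that corner. *)
Lemma up_closed_fingen (U : 'X_{1..m} -> Prop) :
  exists L : seq 'X_{1..m}, {in L, forall u, U u} /\
    forall u, U u -> exists2 g, g \in L & (g <= u)%MM.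
Proof.
suff [L [hL1 hL2]] : exists L : seq 'X_{1..m}, {in L, forall u, U u} /\
    forall u, box 0%MM setT u -> U u -> exists2 g, g \in L & (g <= u)%MM.
  by exists L; split=> // u; apply: hL2; apply/boxP => i; rewrite inE mnm0E.
apply: (@box_ind (fun u => ~ U u) (fun v S => exists L : seq 'X_{1..m},
  {in L, forall u, U u} /\
    forall u, box v S u -> U u -> exists2 g, g \in L & (g <= u)%MM)).
- by move=> v S h; exists [::]; split=> // u /h.
- move=> v S /NNPP Uv; exists [:: v]; split=> [u|u vu _].
    by rewrite inE => /eqP ->.
  by exists v; [rewrite inE | exact: box_lem vu].
- move=> v S i iS [L1 [h1 h1']] [L2 [h2 h2']]; exists (L1 ++ L2); split.
    by move=> u; rewrite mem_cat => /orP [/h1|/h2].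
  move=> u vu Uu; have := box_split v u iS; rewrite vu.
  case: (boolP (box v (S :\ i) u)) => [b _|_].
    by have [g gL] := h1' _ b Uu; exists g; rewrite // mem_cat gL.
  case: (boolP (box (v + U_(i))%MM S u)) => // b _.
  by have [g gL] := h2' _ b Uu; exists g; rewrite // mem_cat gL orbT.
Qed.

End MonomialSets.

(** * Ideals and standard monomials *)

Definition classically_b (P : Prop) : bool :=
  if excluded_middle_informative P then true else false.

Lemma classically_bP (P : Prop) : reflect P (classically_b P).
Proof.
by rewrite /classically_b; case: excluded_middle_informative => h; constructor.
Qed.

Section Ideals.

Variables (k : fieldType) (m : nat).
Implicit Types (f g h : {mpoly k[m]}) (u v : 'X_{1..m}) (Q : pred 'X_{1..m}).
Implicit Types (J P : {mpoly k[m]} -> Prop).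

Lemma mpolyX_neq0 v : 'X_[v] != 0 :> {mpoly k[m]}.
Proof. by rewrite -msupp_eq0 msuppX. Qed.

Lemma mcoeff_sumX (s : seq 'X_{1..m}) (c : 'X_{1..m} -> k) u : uniq s ->
  (\sum_(v <- s) c v *: 'X_[v])@_u = if u \in s then c u else 0.
Proof.
move=> us; rewrite raddf_sum /=; under eq_bigr do rewrite mcoeffZ mcoeffX.
have [uf|uf] := boolP (u \in s).
  rewrite (bigD1_seq u) //= eqxx mulr1 big1 ?addr0 //.
  by move=> v /negbTE vu; rewrite vu mulr0.
rewrite big_seq big1 // => v vs.
by case: eqP => [e|]; [rewrite -e vs in uf | rewrite mulr0].
Qed.

Lemma mpolyE_sub (s : seq 'X_{1..m}) f : uniq s -> {subset msupp f <= s} ->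
  f = \sum_(v <- s) f@_v *: 'X_[v].
Proof.
move=> us sub; apply/mpolyP => u; rewrite mcoeff_sumX //.
by case: ifP => // /negP us'; apply: memN_msupp_eq0; apply/negP => /sub.
Qed.

Definition filt Q f : {mpoly k[m]} := \sum_(u <- msupp f | Q u) f@_u *: 'X_[u].

Lemma mcoeff_filt Q f u : (filt Q f)@_u = if Q u then f@_u else 0.
Proof.
rewrite /filt -big_filter mcoeff_sumX ?filter_uniq ?msupp_uniq // mem_filter.
by case: (Q u) => //=; case: (boolP (u \in msupp f)) => // /memN_msupp_eq0 ->.
Qed.

Lemma filt_is_linear Q : linear (filt Q).
Proof.
move=> c f g; apply/mpolyP => u.
by rewrite mcoeffD mcoeffZ !mcoeff_filt mcoeffD mcoeffZ; case: ifP; rewrite ?mulr0 ?addr0.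
Qed.

HB.instance Definition _ Q :=
  GRing.isLinear.Build k {mpoly k[m]} {mpoly k[m]} _ (filt Q) (filt_is_linear Q).

Lemma filt_id Q f : {in msupp f, forall u, Q u} -> filt Q f = f.
Proof.
move=> h; apply/mpolyP => u; rewrite mcoeff_filt.
by case: ifP => // Qu; case: (boolP (u \in msupp f)) => [/h|/memN_msupp_eq0->//]; rewrite Qu.
Qed.

Lemma filt_0 Q f : {in msupp f, forall u, ~~ Q u} -> filt Q f = 0.
Proof.
move=> h; apply/mpolyP => u; rewrite mcoeff_filt mcoeff0.
by case: ifP => // Qu; case: (boolP (u \in msupp f)) => [/h|/memN_msupp_eq0->//]; rewrite Qu.
Qed.

Lemma msupp_filt Q f u : (u \in msupp (filt Q f)) = (u \in msupp f) && Q u.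
Proof. by rewrite !mcoeff_msupp mcoeff_filt; case: (Q u); rewrite ?andbT ?andbF ?eqxx. Qed.

Lemma filtMX Q f v : filt Q (f * 'X_[v]) = filt (fun u => Q (v + u)%MM) f * 'X_[v].
Proof.
rewrite [in LHS](mpolyE f) [filt _ f]big_mkcond /= !mulr_suml raddf_sum /=.
apply: eq_bigr => u _; rewrite -scalerAl -mpolyXD linearZ /= addmC.
case: ifP => Qu; [rewrite filt_id | rewrite filt_0 ?scaler0 ?mul0r //].
- by rewrite -scalerAl -mpolyXD addmC.
- by move=> w; rewrite msuppX inE => /eqP ->.
- by move=> w; rewrite msuppX inE => /eqP ->; rewrite Qu.
Qed.

Definition ideal J : Prop := J 0 /\ forall c f g, J f -> J g -> J (c * f + g).

Lemma idealD J f g : ideal J -> J f -> J g -> J (f + g).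
Proof. by case=> _ h jf jg; rewrite -[f]mul1r; apply: h. Qed.

Lemma idealM J c f : ideal J -> J f -> J (c * f).
Proof. by case=> h0 h jf; rewrite -[_ * _]addr0; apply: h. Qed.

Lemma idealZ J c f : ideal J -> J f -> J (c *: f).
Proof. by move=> hJ jf; rewrite -mul_mpolyC; apply: idealM. Qed.

Lemma idealN J f : ideal J -> J f -> J (- f).
Proof. by move=> hJ jf; rewrite -mulN1r; apply: idealM. Qed.

Lemma idealB J f g : ideal J -> J f -> J g -> J (f - g).
Proof. by move=> hJ jf jg; apply: idealD => //; apply: idealN. Qed.

Definition lead J u : Prop := exists f, [/\ J f, f != 0 & mlead f = u].

Definition std J : pred 'X_{1..m} := fun u => ~~ classically_b (lead J u).

Lemma stdP J u : reflect (~ lead J u) (std J u).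
Proof. by rewrite /std; case: classically_bP => h; constructor; [apply|]. Qed.

Lemma lead_up J u v : ideal J -> lead J u -> lead J (u + v)%MM.
Proof.
move=> hJ [f [jf f0 <-]]; exists ('X_[v] * f).
split; first exact: idealM.
  by rewrite mulf_neq0 // mpolyX_neq0.
by rewrite mleadM ?mpolyX_neq0 // mleadXm addmC.
Qed.

Lemma std_down_closed J : ideal J -> down_closed (std J).
Proof. by move=> hJ u v /stdP h; apply/stdP => hu; apply: h; apply: lead_up. Qed.

Lemma std_indep J f : {in msupp f, forall u, std J u} -> J f -> f = 0.
Proof.
move=> h jf; apply/eqP; case: (eqVneq f 0) => // f0.
by have /stdP[] := h _ (mlead_supp f0); exists f.
Qed.

(** Division by all of [J] at once, by induction on the leading monomial: a standard leading term is
    kept, any other is cancelled by an element of [J] with the same leading monomial. *)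
Lemma ideal_division J f : ideal J ->
  exists2 g, J (f - g) & {in msupp g, forall u, std J u}.
Proof.
move=> hJ; elim/mleadrect: f => f IH.
have [->|f0] := eqVneq f 0.
  by exists 0; [rewrite subr0; case: hJ | move=> u; rewrite msupp0].
have step h : (mlead h <= mlead f)%O -> h@_(mlead f) = 0 ->
    exists2 g, J (h - g) & {in msupp g, forall u, std J u}.
  move=> le e; have [->|h0] := eqVneq h 0.
    by exists 0; [rewrite subr0; case: hJ | move=> u; rewrite msupp0].
  apply: IH; rewrite lt_neqAle le andbT; apply: contraNneq h0 => e'.
  by rewrite -mleadc_eq0 e' e.
have [std_f|] := boolP (std J (mlead f)).
  have [||g jg sg] := step (f - f@_(mlead f) *: 'X_[mlead f]).
  - apply: le_trans (mleadB_le _ _) _; rewrite leUx lexx /=.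
    by rewrite (le_trans (mleadZ_le _ _)) // mleadXm.
  - by rewrite mcoeffB mcoeffZ mcoeffX eqxx mulr1 subrr.
  exists (f@_(mlead f) *: 'X_[mlead f] + g); first by rewrite opprD addrA.
  move=> u /msuppD_le; rewrite mem_cat => /orP [/msuppZ_le|/sg //].
  by rewrite msuppX inE => /eqP ->.
rewrite negbK => /classically_bP [h [jh h0 eh]].
have [||g jg sg] := step (f - (f@_(mlead f) / h@_(mlead h)) *: h).
- apply: le_trans (mleadB_le _ _) _; rewrite leUx lexx /= -eh.
  exact: mleadZ_le.
- by rewrite mcoeffB mcoeffZ eh divfK ?subrr // -eh mleadc_eq0.
exists g => //; rewrite -[f](subrK ((f@_(mlead f) / h@_(mlead h)) *: h)) addrAC.
by apply: idealD => //; apply: idealZ.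
Qed.

(** Otherwise there is a strictly increasing sequence [C] in [F]. By Dickson's lemma finitely many
    exponents generate all the leading ones, and some [C n] has them all; division by [C n] then
    shows that [C n.+1] is no larger. *)
Lemma ideal_noetherian (F : ({mpoly k[m]} -> Prop) -> Prop) J0 :
  (forall J, F J -> ideal J) -> F J0 ->
  exists P, [/\ F P, forall f, J0 f -> P f
    & forall J, F J -> (forall f, P f -> J f) -> forall f, J f -> P f].
Proof.
move=> FI FJ0; apply: NNPP => hmax.
pose T := {J | F J /\ forall f, J0 f -> J f}.
have next (t : T) : exists t' : T, (forall f, sval t f -> sval t' f) /\
    exists f, sval t' f /\ ~ sval t f.
  case: t => J [FJ JJ] /=; apply: NNPP => h; apply: hmax; exists J; split=> //.
  move=> J' FJ' JJ' f J'f; apply: NNPP => nJf; apply: h.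
  have FJ'0 : F J' /\ forall f, J0 f -> J' f by split=> // ? /JJ /JJ'.
  by exists (exist _ J' FJ'0); split=> //; exists f.
pose nx t := sval (constructive_indefinite_description _ (next t)).
have nxP t := svalP (constructive_indefinite_description _ (next t)).
pose t0 : T := exist _ J0 (conj FJ0 (fun f (jf : J0 f) => jf)).
pose C n := sval (iter n nx t0).
have CS n f : C n f -> C n.+1 f by case: (nxP (iter n nx t0)) => h _; apply: h.
have Cle n n' f : (n <= n')%N -> C n f -> C n' f.
  by move=> /subnK <-; elim: (n' - n)%N => // q IH h; rewrite addSn; apply/CS/IH.
have CI n : ideal (C n) by apply: FI; rewrite /C; case: (iter n nx t0) => J /= [].
have [L [LU hL]] := up_closed_fingen (fun u => exists n, lead (C n) u).
have {LU} [n hn] : exists n, {in L, forall u, lead (C n) u}.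
  elim: L {hL} LU => [|v L IH] h; first by exists 0%N.
  have [|n hn] := IH; first by move=> u uL; apply: h; rewrite inE uL orbT.
  have [n' [f [jf f0 ef]]] := h v (mem_head _ _).
  exists (maxn n n') => u; rewrite inE => /orP [/eqP ->|/hn].
    by exists f; split=> //; apply: Cle jf; rewrite leq_maxr.
  by case=> g [jg g0 eg]; exists g; split=> //; apply: Cle jg; rewrite leq_maxl.
case: (nxP (iter n nx t0)) => _ [f [Cf nCf]]; apply: nCf; rewrite -/(C n).
have [g jg sg] := ideal_division f (CI n).
have [g0|g0] := eqVneq g 0; first by rewrite g0 subr0 in jg.
have Cg : C n.+1 g.
  by rewrite -[g](subKr f); apply: idealB => //; apply: CS.
have [|w wL /submK] := hL (mlead g); first by exists n.+1, g.
have /stdP h := sg _ (mlead_supp g0); rewrite addmC => e; case: h; rewrite -e.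
exact: lead_up (hn _ wL).
Qed.

End Ideals.

(** * Krull dimension *)

(** Taking [N = C] suffices: [C.+1 ^ (n - D)] exceeds [C] as soon as [D < n]. *)
Lemma leq_exponent_of_growth (n D C : nat) :
  (forall N, N.+1 ^ n <= C * N.+1 ^ D)%N -> (n <= D)%N.
Proof.
move=> h; rewrite leqNgt; apply/negP => lt_Dn.
have := h C; rewrite -(subnK lt_Dn) addnS -addSn expnD leq_pmul2r ?expn_gt0 //.
by rewrite leqNgt expnS (leq_trans (ltnSn C)) // leq_pmulr // expn_gt0.
Qed.

Section Dimension.

Variables (k : fieldType) (m : nat) (w : 'I_m -> nat).
Hypothesis w_gt0 : forall i, (0 < w i)%N.
Implicit Types (f g h : {mpoly k[m]}) (u v : 'X_{1..m}) (S : {set 'I_m}).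
Implicit Types (J P : {mpoly k[m]} -> Prop).

Definition wt u : nat := (\sum_i u i * w i)%N.

Lemma wtD u v : wt (u + v)%MM = (wt u + wt v)%N.
Proof. by rewrite /wt -big_split; apply: eq_bigr => i _; rewrite mnmDE mulnDl. Qed.

Lemma wt0 : wt 0%MM = 0%N.
Proof. by rewrite /wt big1 // => i _; rewrite mnm0E. Qed.

Lemma wt1 i : wt U_(i)%MM = w i.
Proof.
rewrite /wt (bigD1 i) //= mnm1E eqxx mul1n big1 ?addn0 // => j /negbTE ji.
by rewrite mnm1E eq_sym ji.
Qed.

Lemma leq_wt u i : (u i <= wt u)%N.
Proof. by rewrite /wt (bigD1 i) //= (leq_trans (leq_pmulr _ (w_gt0 i))) // leq_addr. Qed.

Definition wbounded N f : Prop := {in msupp f, forall u, (wt u < N)%N}.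

Definition whomog n f : Prop := {in msupp f, forall u, wt u = n}.

(** Arbitrary sets of weights are allowed, to cover truncations as well as homogeneous
    components. *)
Definition wgraded J : Prop :=
  forall (Q : pred nat) f, J f -> J (filt (fun u => Q (wt u)) f).

Lemma msuppM_ex f g u : u \in msupp (f * g) ->
  exists u1 u2, [/\ u1 \in msupp f, u2 \in msupp g & u = (u1 + u2)%MM].
Proof. by move/msuppM_le/allpairsP => [[u1 u2] /= [h1 h2 ->]]; exists u1, u2. Qed.

Lemma filtM_whomog (Q : pred nat) n f g : whomog n f ->
  filt (fun u => Q (wt u)) (g * f) = filt (fun u => Q (wt u + n)%N) g * f.
Proof.
move=> hf; rewrite [f in LHS]mpolyE [f in RHS]mpolyE !mulr_sumr raddf_sum.
apply: eq_big_seq => u uf /=; rewrite -!scalerAr linearZ /= filtMX.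
congr (_ *: (_ * _)); apply/mpolyP => v; rewrite !mcoeff_filt.
by rewrite wtD (hf _ uf) addnC.
Qed.

Lemma filt_wbounded n f : wbounded n (filt (fun u => wt u < n)%N f).
Proof. by move=> u; rewrite msupp_filt => /andP []. Qed.

Lemma wbounded0 f : wbounded 0 f -> f = 0.
Proof. by move=> h; apply/eqP; apply: contraT => /mlead_supp /h. Qed.

Definition sum_ideal J f : {mpoly k[m]} -> Prop :=
  fun h => exists p c, J p /\ h = p + c * f.

Lemma sum_ideal_ideal J f : ideal J -> ideal (sum_ideal J f).
Proof.
move=> hJ; split; first by exists 0, 0; split; [case: hJ | rewrite mul0r addr0].
move=> c _ _ [p [a [jp ->]]] [q [b [jq ->]]].
exists (c * p + q), (c * a + b); split; first by case: hJ => _; apply.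
by rewrite mulrDr mulrDl mulrA addrACA.
Qed.

Lemma sum_ideal_sub J f g : J g -> sum_ideal J f g.
Proof. by move=> jg; exists g, 0; rewrite mul0r addr0. Qed.

Lemma sum_ideal_gen J f : ideal J -> sum_ideal J f f.
Proof. by move=> [j0 _]; exists 0, 1; rewrite mul1r add0r. Qed.

Lemma sum_ideal_wgraded J n f : wgraded J -> whomog n f -> wgraded (sum_ideal J f).
Proof.
move=> gJ hf Q _ [p [c [jp ->]]]; rewrite raddfD /= (filtM_whomog _ _ hf).
by eexists _, _; split; last reflexivity; apply: gJ.
Qed.

Definition prime_ideal P : Prop :=
  [/\ ideal P, ~ P 1 & forall f g, P (f * g) -> P f \/ P g].

(** Induction on the sum of the weight bounds. The product of the top components of [f] and [g] is a
    component of [f * g], so one of the two lies in [P]; subtracting it lowers the bound of its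
    factor. *)
Lemma prime_of_whomog P : ideal P -> wgraded P -> ~ P 1 ->
  (forall p q f g, whomog p f -> whomog q g -> P (f * g) -> P f \/ P g) ->
  prime_ideal P.
Proof.
move=> hP gP P1 hh; split=> // f g.
have wex h : exists n, wbounded n h.
  exists (\max_(u <- msupp h) (wt u).+1)%N => u uh.
  by rewrite (big_rem u) //= leq_max leqnn.
have [p pf] := wex f; have [q qg] := wex g.
have [N] := ubnP (p + q)%N; elim: N p q f g pf qg => // N IH p q f g pf qg le hfg.
have zero h : wbounded 0 h -> P h.
  by move/wbounded0 ->; case: hP.
case: p pf le => [|p] pf le; first by left; apply: zero.
case: q qg le => [|q] qg le; first by right; apply: zero.
pose top n h := filt (fun u => wt u == n) h.
have topP n h : whomog n (top n h).
  by move=> u; rewrite msupp_filt => /andP [_ /eqP].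
have lowP n h : wbounded n.+1 h -> wbounded n (h - top n h).
  move=> hb u; rewrite mcoeff_msupp mcoeffB mcoeff_filt.
  case: (wt u =P n) => [_|/eqP ne]; first by rewrite subrr eqxx.
  by rewrite subr0 -mcoeff_msupp ltn_neqAle ne => /hb; rewrite ltnS.
have P_top : P (top p f * top q g).
  have := gP (fun n => n == p + q)%N _ hfg.
  have -> : f * g = (f - top p f) * (g - top q g) + (f - top p f) * top q g
    + (top p f * (g - top q g) + top p f * top q g) by ring.
  move: (lowP _ _ pf) (lowP _ _ qg) => lf lg.
  rewrite !(raddfD (filt _)) /=.
  rewrite [X in _ + (_ + X)]filt_id; last first.
    by move=> _ /msuppM_ex [u1 [u2 [/topP h1 /topP h2 ->]]]; rewrite wtD h1 h2.
  rewrite !filt_0 ?add0r //; move=> _ /msuppM_ex [u1 [u2 [h1 h2 ->]]]; rewrite wtD.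
  - by have := lg _ h2; rewrite (topP _ _ _ h1); lia.
  - by have := lf _ h1; rewrite (topP _ _ _ h2); lia.
  - by have := lf _ h1; have := lg _ h2; lia.
case: (hh _ _ _ _ (topP p f) (topP q g) P_top) => ht.
- have [||h|h] := IH p q.+1 (f - top p f) g (lowP _ _ pf) qg.
  + by move: le; lia.
  + by rewrite mulrBl; apply: idealB => //; rewrite mulrC; apply: idealM.
  + by left; rewrite -[f](subrK (top p f)); apply: idealD.
  + by right.
- have [||h|h] := IH p.+1 q f (g - top q g) pf (lowP _ _ qg).
  + by move: le; lia.
  + by rewrite mulrBr; apply: idealB => //; apply: idealM.
  + by left.
  + by right; rewrite -[g](subrK (top q g)); apply: idealD.
Qed.

Definition onvars S f : Prop := {in msupp f, forall u, box 0%MM S u}.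

Lemma box0P S u : reflect (forall i, i \notin S -> u i = 0%N) (box 0%MM S u).
Proof.
apply: (iffP (boxP _ _ _)) => h i; have := h i; rewrite mnm0E.
  by case: ifP => // _ /eqP.
by case: (i \in S) => // ->.
Qed.

Lemma onvarsM S f g : onvars S f -> onvars S g -> onvars S (f * g).
Proof.
move=> hf hg _ /msuppM_ex [u1 [u2 [/hf /box0P h1 /hg /box0P h2 ->]]].
by apply/box0P => i iS; rewrite mnmDE h1 ?h2.
Qed.

(** That is, the variables indexed by [S] are algebraically independent modulo [J]. *)
Definition trivial_cap J S : Prop := forall f, J f -> onvars S f -> f = 0.

Lemma trivial_cap_sub J S S' : S' \subset S -> trivial_cap J S -> trivial_cap J S'.
Proof.
move=> /subsetP sS h f jf of'; apply: h => // u /of' /box0P h.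
by apply/box0P => i iS; apply: h; apply: contra iS; apply: sS.
Qed.

(** The leading exponent of a nonzero element of [J] in [k[z_S]], translated by [v], would lie in
    the box and yet be a leading exponent of [J]. *)
Lemma trivial_cap_of_box J v S : ideal J -> (forall u, box v S u -> std J u) ->
  trivial_cap J S.
Proof.
move=> hJ h f jf fS; apply/eqP; case: (eqVneq f 0) => // f0.
have /stdP[] : std J (v + mlead f)%MM.
  apply: h; apply/boxP => i; have /boxP/(_ i) := fS _ (mlead_supp f0).
  by rewrite mnmDE mnm0E; case: ifP => [_ _|_ /eqP ->]; rewrite ?leq_addr ?addn0.
exists ('X_[v] * f); split; first exact: idealM.
  by rewrite mulf_neq0 // mpolyX_neq0.
by rewrite mleadM ?mpolyX_neq0 // mleadXm.
Qed.

(** Take [P] maximal among the graded ideals above [J] with trivial intersection. For homogeneous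
    [f] and [g] outside [P], both [P + (f)] and [P + (g)] contain nonzero elements of [k[z_S]];
    their product is nonzero, and lies in [P] if [f * g] does. *)
Lemma exists_prime_trivial_cap J S : ideal J -> wgraded J -> trivial_cap J S ->
  exists P, [/\ prime_ideal P, wgraded P, trivial_cap P S & forall f, J f -> P f].
Proof.
move=> hJ gJ tJ.
have [||P [[hP gP tP] JP Pmax]] := @ideal_noetherian k m
  (fun J => [/\ ideal J, wgraded J & trivial_cap J S]) J.
- by move=> ? [].
- by [].
exists P; split=> //; apply: prime_of_whomog => //.
  move=> /tP h; have /eqP : (1 : {mpoly k[m]}) = 0; last by rewrite oner_eq0.
  by apply: h => u; rewrite msupp1 inE => /eqP ->; apply: box_refl.
have key n f : whomog n f -> ~ P f ->
    exists p c, [/\ P p, p + c * f != 0 & onvars S (p + c * f)].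
  move=> hf Pf; apply: NNPP => hn; apply: Pf.
  apply: (Pmax (sum_ideal P f)); last exact: sum_ideal_gen.
    split; [exact: sum_ideal_ideal | exact: sum_ideal_wgraded hf |].
    move=> _ [p [c [Pp ->]]] hS; apply: NNPP => /eqP h0; apply: hn.
    by exists p, c.
  by move=> g; apply: sum_ideal_sub.
move=> p q f g hf hg Pfg; apply: NNPP => hn.
have [a [b [Pa n1 o1]]] := key _ _ hf (fun Pf => hn (or_introl Pf)).
have [a' [b' [Pa' n2 o2]]] := key _ _ hg (fun Pg => hn (or_intror Pg)).
suff /tP/(_ (onvarsM o1 o2))/eqP : P ((a + b * f) * (a' + b' * g)).
  by rewrite mulf_eq0 (negbTE n1) (negbTE n2).
rewrite mulrDl; apply: idealD => //; first by rewrite mulrC; apply: idealM.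
rewrite mulrDr; apply: idealD => //; first exact: idealM.
have -> : b * f * (b' * g) = (b * b') * (f * g) by ring.
exact: idealM.
Qed.

(* The points of [v + N^S] at distance at most [N] from [v] in each coordinate. *)
Definition box_points N v S : seq 'X_{1..m} :=
  [seq (v + [multinom (val (g i)) | i < m])%MM |
     g : {ffun 'I_m -> 'I_N.+1} in pffun_on ord0 S predT].

Lemma size_box_points N v S : size (box_points N v S) = (N.+1 ^ #|S|)%N.
Proof.
rewrite size_map -cardE card_pffun_on.
by rewrite (eq_card (B := 'I_N.+1)) ?card_ord //; apply: eq_card.
Qed.

Lemma mem_box_points N v S u : box v S u -> (wt u <= N)%N -> u \in box_points N v S.
Proof.
move=> vu uN; have leu i : ((u - v)%MM i <= N)%N.
  by rewrite mnmBE (leq_trans (leq_subr _ _)) // (leq_trans (leq_wt u i)).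
pose g := [ffun i => inord ((u - v)%MM i)] : {ffun 'I_m -> 'I_N.+1}.
apply/imageP; exists g; last first.
  rewrite -{1}(submK (box_lem vu)) addmC; congr (_ + _)%MM; apply/mnmP => i.
  by rewrite [RHS]mnmE ffunE /= inordK // ltnS.
apply/pffun_onP; split=> //; apply/subsetP => i; rewrite inE ffunE /=.
have /boxP/(_ i) := vu; case: ifP => // _ /eqP ui.
by rewrite mnmBE ui subnn -val_eqE /= inordK // eqxx.
Qed.

Lemma box_points_box N v S u : u \in box_points N v S -> box v S u.
Proof.
move=> /imageP [g /pffun_onP [gS _] ->]; apply/boxP => i; rewrite !mnmE.
case: ifP => iS; first exact: leq_addr.
have /eqP -> : g i == ord0.
  by apply: contraFT iS => gi; apply: (subsetP gS); rewrite inE.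
by rewrite addn0.
Qed.

Lemma uniq_box_points N v S : uniq (box_points N v S).
Proof.
rewrite map_inj_uniq ?enum_uniq // => g g' /mnmP h; apply/ffunP => i.
by apply/val_inj; have := h i; rewrite !mnmDE !mnmE => /addnI.
Qed.

Definition kidl := (idfun : {rmorphism k -> k}).

Lemma ksubspace_ideal J : ideal J -> ksubspace kidl J.
Proof.
move=> hJ; split; first by case: hJ.
by move=> c f g jf jg; apply: idealD => //; apply: idealZ.
Qed.

Lemma wgraded_division J N f : ideal J -> wgraded J -> wbounded N f ->
  exists g, [/\ J (f - g), wbounded N g & {in msupp g, forall u, std J u}].
Proof.
move=> hJ gJ hf; have [g jg sg] := ideal_division f hJ.
exists (filt (fun u => wt u < N)%N g); split.
- have := gJ (fun n => n < N)%N _ jg; rewrite raddfB /= [X in X - _]filt_id //.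
- exact: filt_wbounded.
- by move=> u; rewrite msupp_filt => /andP [/sg].
Qed.

Definition std_points (L : seq ('X_{1..m} * {set 'I_m})) N : seq 'X_{1..m} :=
  undup (flatten [seq box_points N x.1 x.2 | x <- L]).

Lemma size_std_points (L : seq ('X_{1..m} * {set 'I_m})) N D :
  (forall x, x \in L -> #|x.2| <= D)%N ->
  (size (std_points L N) <= size L * N.+1 ^ D)%N.
Proof.
move=> hL; apply: leq_trans (size_undup _) _; rewrite size_flatten /shape -map_comp.
elim: L hL => //= x L IH hL; rewrite mulSn leq_add //.
  by rewrite size_box_points leq_pexp2l // hL // mem_head.
by apply: IH => y yL; apply: hL; rewrite inE yL orbT.
Qed.

Lemma mem_std_points (D : pred 'X_{1..m}) (L : seq ('X_{1..m} * {set 'I_m})) N u :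
  (forall u, count (fun x => box x.1 x.2 u) L = D u) -> D u -> (wt u <= N)%N ->
  u \in std_points L N.
Proof.
move=> hL Du uN; have : has (fun x => box x.1 x.2 u) L by rewrite has_count hL Du.
move=> /hasP [x xL hx]; rewrite mem_undup; apply/flattenP.
by exists (box_points N x.1 x.2); [apply: map_f | apply: mem_box_points].
Qed.

Lemma spans_std_points J (L : seq ('X_{1..m} * {set 'I_m})) N : ideal J -> wgraded J ->
  (forall u, count (fun x => box x.1 x.2 u) L = std J u) ->
  spans kidl (wbounded N.+1) J (std_points L N) (fun u => 'X_[u]).
Proof.
move=> hJ gJ hL f hf; have [g [jg bg sg]] := wgraded_division hJ gJ hf.
exists (fun u => g@_u); rewrite /lincomb /= -mpolyE_sub ?undup_uniq //.
by move=> u ug; apply: mem_std_points hL (sg _ ug) (bg _ ug).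
Qed.

(** The monomials in [z_S] with exponents at most [N] respect the weight bound and are independent
    modulo [J]. *)
Lemma trivial_cap_growth J S N (I : eqType) (s : seq I) e :
  ideal J -> trivial_cap J S ->
  spans kidl (wbounded (N * \sum_i w i).+1) J s e -> (N.+1 ^ #|S| <= size s)%N.
Proof.
move=> hJ tJ hs; rewrite -(size_box_points N 0%MM).
apply: (indep_leq_spans (e := fun u => 'X_[u]) (ksubspace_ideal hJ)
  (uniq_box_points _ _ _) _ _ hs).
- move=> _ /imageP [g gS ->] u; rewrite msuppX inE => /eqP ->; rewrite ltnS add0m.
  rewrite /wt big_distrr leq_sum // => i _; rewrite mnmE leq_mul2r -ltnS ltn_ord.
  by rewrite orbT.
- move=> c jc u us; rewrite /lincomb /= in jc.
  have := mcoeff_sumX c u (uniq_box_points N 0%MM S); rewrite us => <-.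
  rewrite (tJ _ jc) ?mcoeff0 // => {us}u; rewrite mcoeff_msupp.
  rewrite mcoeff_sumX ?uniq_box_points //; case: ifP; last by rewrite eqxx.
  by move=> /box_points_box.
Qed.

(** An expansion in powers of ['X_i] with coefficients standard modulo [P + (z_i)]. Each division
    lowers the weight bound, so the powers below [N.+1] suffice. *)
Lemma spans_sum_ideal_variable P i (L : seq ('X_{1..m} * {set 'I_m})) N :
  ideal P -> wgraded P ->
  (forall u, count (fun x => box x.1 x.2 u) L = std (sum_ideal P 'X_i) u) ->
  spans kidl (wbounded N.+1) P [seq (j, u) | j <- iota 0 N.+1, u <- std_points L N]
    (fun x => 'X_[x.2] * 'X_i ^+ x.1).
Proof.
move=> hP gP hL; set J := sum_ideal P 'X_i in hL.
have hX : whomog (w i) 'X_i by move=> u; rewrite msuppX inE => /eqP ->; rewrite wt1.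
have hJ : ideal J by apply: sum_ideal_ideal.
have gJ : wgraded J by apply: sum_ideal_wgraded hX.
suff key n f : (n <= N.+1)%N -> wbounded n f -> exists c : nat -> 'X_{1..m} -> k,
    P (f - \sum_(j < n) \sum_(u <- std_points L N) c j u *: ('X_[u] * 'X_i ^+ j)).
  move=> f /(key _ _ (leqnn _)) [c hc]; exists (fun x => c x.1 x.2).
  by rewrite /lincomb big_allpairs -[iota _ _]/(index_iota 0 N.+1) big_mkord.
elim: n f => [|n IH] f nN fn.
  exists (fun _ _ => 0); rewrite big_ord0 subr0; rewrite (wbounded0 fn); by case: hP.
have [g [[p [c [Pp epc]]] gn sg]] := wgraded_division hJ gJ fn.
(* Truncating [f - g = p + c * 'X_i] to weights below [n.+1] turns [c] into [c'], whose weights are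
   below [n] because [w i] is positive. *)
pose c' := filt (fun u => wt u + w i < n.+1)%N c.
have [|c'' hc''] := IH c' (ltnW nN).
  move=> u; rewrite msupp_filt => /andP [_]; have := w_gt0 i; lia.
exists (fun j => if j is j'.+1 then c'' j' else fun u => g@_u).
rewrite big_ord_recl /=.
have -> : \sum_(u <- std_points L N) g@_u *: ('X_[u] * 'X_i ^+ 0) = g.
  rewrite [RHS](mpolyE_sub (s := std_points L N)) ?undup_uniq //.
    by apply: eq_bigr => u _; rewrite expr0 mulr1.
  move=> u ug; apply: mem_std_points hL (sg _ ug) _.
  by have := gn _ ug; rewrite ltnS => /leq_trans; apply.
rewrite opprD addrA.
pose p' := filt (fun u => wt u < n.+1)%N p.
have Pp' : P p' by apply: (gP (fun x => x < n.+1)%N).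
have e : f - g - p' = c' * 'X_i.
  have ecX : c * 'X_i = (f - g) - p by rewrite epc addrC addKr.
  rewrite -(filtM_whomog (fun x => x < n.+1)%N _ hX) ecX.
  rewrite raddfB /= -/p'; congr (_ - _); rewrite filt_id //.
  by move=> u /msuppB_le; rewrite mem_cat => /orP [/fn|/gn].
have -> : f - g = p' + c' * 'X_i by rewrite -e [RHS]addrC subrK.
rewrite -addrA; apply: idealD => //.
have := idealM 'X_i hP hc''; congr P; rewrite mulrBr mulrC; congr (_ - _).
rewrite mulr_sumr; apply: eq_bigr => j _; rewrite mulr_sumr; apply: eq_bigr => u _.
rewrite -scalerAr; congr (_ *: _); rewrite /bump leq0n add1n exprS; ring.
Qed.

Lemma exists_card_subset (T : finType) (A : {set T}) n : (n <= #|A|)%N ->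
  exists2 B : {set T}, B \subset A & #|B| = n.
Proof.
move=> nA; exists [set x in take n (enum A)].
  by apply/subsetP => x; rewrite inE => /mem_take; rewrite mem_enum.
rewrite cardsE (card_uniqP _) ?take_uniq ?enum_uniq // size_takel //.
by rewrite -cardE.
Qed.

(* Otherwise all the boxes of standard monomials of [P + (z_i)] would have fewer
   than [D] directions; as [f = (standard part) + p + z_i * g] with [g] of smaller
   weight, [k[z] / P] would grow like [N^D], while it contains [k[z_S]]. *)
Lemma trivial_cap_sum_variable P S i D : ideal P -> wgraded P -> trivial_cap P S ->
  #|S| = D.+1 -> exists2 S' : {set 'I_m}, #|S'| = D & trivial_cap (sum_ideal P 'X_i) S'.
Proof.
move=> hP gP tP cS; have hJ : ideal (sum_ideal P 'X_i) by apply: sum_ideal_ideal.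
have [L hL] := stanley_decomposition (std_down_closed hJ).
have [[x [xL /exists_card_subset [S' sS' cS']]]|hn] :=
    excluded_middle_informative (exists x, x \in L /\ (D <= #|x.2|)%N).
  exists S' => //; apply: trivial_cap_sub sS' _.
  by apply: (trivial_cap_of_box (v := x.1)) => // u; apply: box_sub_of_count hL xL.
have small x : x \in L -> (#|x.2| < D)%N.
  by move=> xL; rewrite ltnNge; apply/negP => h; apply: hn; exists x.
suff : (D.+1 <= D)%N by rewrite ltnn.
pose W := (\sum_i w i)%N.
(* The factor [W.+1 ^ D] comes from [(N * W).+1 <= W.+1 * N.+1]. *)
apply: (@leq_exponent_of_growth _ _ (size L * W.+1 ^ D)) => N.
have sp := spans_sum_ideal_variable (N := N * W) hP gP hL.
have := trivial_cap_growth hP tP sp; rewrite cS => /leq_trans; apply.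
rewrite size_allpairs size_iota -mulnA -expnMn.
apply: (@leq_trans (size L * (N * W).+1 ^ D)).
  (* If [D = 0] then [L] is empty. Otherwise the powers of ['X_i] account for one factor
     [(N * W).+1], and the boxes, of fewer than [D] directions, for at most [D - 1] others. *)
  case: L hL hn small sp => [|x L] hL hn small sp.
    by rewrite /std_points /= muln0.
  case: D small {cS hn} => [/(_ x (mem_head _ _))//|D] small.
  rewrite expnS mulnCA leq_mul2l; apply/orP; right.
  by apply: size_std_points => y /small.
rewrite leq_mul2l; apply/orP; right.
case: (D) => [|D']; first by rewrite !expn0.
by rewrite leq_exp2r //; lia.
Qed.

Definition strict_chain n (P : 'I_n.+1 -> {mpoly k[m]} -> Prop) : Prop :=
  (forall i, prime_ideal (P i)) /\
  (forall i j : 'I_n.+1, (i < j)%N ->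
     (forall f, P i f -> P j f) /\ ~ (forall f, P j f -> P i f)).

Lemma exists_chain_trivial_cap J S : ideal J -> wgraded J -> trivial_cap J S ->
  exists2 P : 'I_(#|S|).+1 -> {mpoly k[m]} -> Prop,
    strict_chain P & forall i f, J f -> P i f.
Proof.
move: {2}#|S| (erefl #|S|) => D; elim: D J S => [|D IH] J S cS hJ gJ tJ.
  have [P [pP gP tP JP]] := exists_prime_trivial_cap hJ gJ tJ.
  rewrite cS; exists (fun _ => P); last by move=> _.
  by split=> // i j; rewrite (ord1 i) (ord1 j).
have [P0 [pP gP tP JP]] := exists_prime_trivial_cap hJ gJ tJ.
have /card_gt0P [i iS] : (0 < #|S|)%N by rewrite cS.
have hP : ideal P0 by case: pP.
have [S' cS' tS'] := trivial_cap_sum_variable i hP gP tP cS.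
have hX : whomog (w i) 'X_i by move=> u; rewrite msuppX inE => /eqP ->; rewrite wt1.
have [P' [prP chP] JP'] := IH _ _ cS' (sum_ideal_ideal 'X_i hP) (sum_ideal_wgraded gP hX) tS'.
rewrite cS' in P' prP chP JP'; rewrite cS.
exists (fun j => if unlift ord0 j is Some j' then P' j' else P0); last first.
  by move=> j f /JP P0f; case: unliftP => // j' _; apply: JP'; apply: sum_ideal_sub.
split=> [j|j1 j2]; first by case: unliftP.
case: unliftP => [j1' ->|->]; case: unliftP => [j2' ->|->] //; first exact: chP.
move=> _; split=> [f P0f|h]; first by apply: JP'; apply: sum_ideal_sub.
(* Strictness: ['X_i] is a nonzero element of [k[z_S]], so it cannot lie in [P0]. *)
have PX : P0 'X_i by apply: h; apply: JP'; apply: sum_ideal_gen.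
have XS : onvars S 'X_i.
  move=> u; rewrite msuppX inE => /eqP ->; apply/box0P => j jS.
  by rewrite mnm1E; case: eqP => // ij; rewrite -ij iS in jS.
by have /eqP := tP _ PX XS; rewrite (negbTE (mpolyX_neq0 _ _)).
Qed.

(** * Growth of independent families along a chain of primes *)

Lemma wbounded_ex f : exists n, wbounded n.+1 f.
Proof.
exists (\max_(u <- msupp f) wt u)%N => u uf.
by rewrite ltnS (big_rem u) //= leq_max leqnn.
Qed.

Lemma wboundedM n n' f g : wbounded n.+1 f -> wbounded n'.+1 g ->
  wbounded (n + n').+1 (f * g).
Proof.
move=> hf hg _ /msuppM_ex [u1 [u2 [/hf h1 /hg h2 ->]]]; rewrite wtD; lia.
Qed.

Lemma wboundedX n f N : wbounded n.+1 f -> wbounded (N * n).+1 (f ^+ N).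
Proof.
move=> hf; elim: N => [|N IH]; last by rewrite exprS mulSn; apply: wboundedM.
by move=> u; rewrite expr0 msupp1 inE => /eqP ->; rewrite wt0.
Qed.

Lemma wboundedW n n' f : (n <= n')%N -> wbounded n f -> wbounded n' f.
Proof. by move=> le h u /h /leq_trans; apply. Qed.

(* If [x] lies in the prime [P'] but not in the prime [P], reducing a relation
   modulo [P'] kills all of its terms but the constant one, and [x] can then be
   cancelled modulo [P]. *)
Lemma indep_powers (P P' : {mpoly k[m]} -> Prop) x (I : eqType) (s : seq I) e N :
  prime_ideal P -> prime_ideal P' -> (forall f, P f -> P' f) -> P' x -> ~ P x ->
  indep kidl P' s e ->
  indep kidl P [seq (j, y) | j <- iota 0 N, y <- s] (fun t => x ^+ t.1 * e t.2).
Proof.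
move=> [hP P1 primeP] [hP' _ _] PP' P'x Px hi c hc.
suff key (d : nat -> I -> k) : P (\sum_(j < N) x ^+ j * \sum_(y <- s) d j y *: e y) ->
    forall j, (j < N)%N -> {in s, forall y, d j y = 0}.
  move=> _ /allpairsP [[j y] [/= jN ys ->]]; apply: (key (fun j y => c (j, y))) ys.
    move: hc; congr P; have -> : iota 0 N = index_iota 0 N by rewrite /index_iota subn0.
    rewrite /lincomb big_allpairs big_mkord; apply: eq_bigr => i _; rewrite mulr_sumr.
    by apply: eq_bigr => z _; rewrite -scalerAr.
  by move: jN; rewrite mem_iota.
elim: N d {c hc} => // N IH d; rewrite big_ord_recl expr0 mul1r /=.
set q := \sum_(y <- s) _.
have -> : \sum_(i < N) x ^+ bump 0 i * \sum_(y <- s) d (bump 0 i) y *: e y =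
    x * \sum_(i < N) x ^+ i * \sum_(y <- s) d i.+1 y *: e y.
  by rewrite mulr_sumr; apply: eq_bigr => i _; rewrite mulrA -exprS.
set r := \sum_(i < N) _ => Pqr.
have d0 : {in s, forall y, d 0%N y = 0}.
  apply: hi; rewrite -[lincomb _ _ _ _]/q -[q](addrK (x * r)).
  by apply: idealB => //; [apply: PP' | rewrite mulrC; apply: idealM].
have q0 : q = 0 by rewrite /q big_seq big1 // => y ys; rewrite d0 // scale0r.
rewrite q0 add0r in Pqr; case: (primeP _ _ Pqr) => // Pr.
by case=> [|j] jN; [exact: d0 | exact: (IH (fun j => d j.+1) Pr j jN)].
Qed.

(** The family of the remaining chain is multiplied by the first [N] powers of an element of the
    second prime outside the first. [W] adds up the weight bounds of the elements so chosen. *)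
Lemma chain_indep n (P : 'I_n.+1 -> {mpoly k[m]} -> Prop) : strict_chain P ->
  exists W, forall N, exists (I : eqType) (s : seq I) (e : I -> {mpoly k[m]}),
    [/\ uniq s, size s = (N ^ n)%N, {in s, forall y, wbounded (N * W).+1 (e y)}
      & indep kidl (P ord0) s e].
Proof.
elim: n P => [|n IH] P [prP chP].
  exists 0%N => N; exists unit, [:: tt], (fun _ => 1); split=> //.
    by move=> _ _ u; rewrite msupp1 inE => /eqP ->; rewrite wt0.
  move=> c; rewrite /lincomb big_seq1 /= => hc -[] _; apply/eqP.
  have [hP P1 _] := prP ord0; apply: contra_notT P1 => c0.
  by have := idealZ (c tt)^-1 hP hc; rewrite scalerK.
have [|W hW] := IH (fun j => P (fintype.lift ord0 j)).
  by split=> [j|j1 j2 lt]; [exact: prP | apply: chP; rewrite /= /bump !leq0n !add1n].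
have [PP' /not_all_ex_not [x hx]] := chP ord0 (fintype.lift ord0 ord0) isT.
have [P'x Px] := imply_to_and _ _ hx.
have [b hb] := wbounded_ex x.
exists (b + W)%N => N; have [I [s [e [us sz he hi]]]] := hW N.
exists (nat * I)%type, [seq (j, y) | j <- iota 0 N, y <- s], (fun t => x ^+ t.1 * e t.2).
split.
- by apply: allpairs_uniq => //; [exact: iota_uniq | move=> [? ?] [? ?]].
- by rewrite size_allpairs size_iota sz expnS.
- move=> _ /allpairsP [[j y] [/= jN ys ->]]; rewrite mulnDr.
  apply: (wboundedW _ (wboundedM (wboundedX (N := j) hb) (he y ys))).
  rewrite ltnS leq_add2r leq_mul2r; move: jN; rewrite mem_iota => /andP [_ /ltnW ->].
  by rewrite orbT.
- exact: indep_powers hi.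
Qed.

Lemma leq_chain_std n (P : 'I_n.+1 -> {mpoly k[m]} -> Prop) J
    (L : seq ('X_{1..m} * {set 'I_m})) D :
  strict_chain P -> (forall f, J f -> P ord0 f) -> ideal J -> wgraded J ->
  (forall u, count (fun x => box x.1 x.2 u) L = std J u) ->
  (forall x, x \in L -> #|x.2| <= D)%N -> (n <= D)%N.
Proof.
move=> ch JP hJ gJ hL hD; have [W hW] := chain_indep ch.
apply: (@leq_exponent_of_growth _ _ (size L * W.+1 ^ D)) => N.
have [I [s [e [us <- he hi]]]] := hW N.+1.
have hi' : indep kidl J s e by move=> c /JP; apply: hi.
have := indep_leq_spans (ksubspace_ideal hJ) us he hi' (spans_std_points hJ gJ hL).
move=> /leq_trans; apply; apply: leq_trans (size_std_points _ hD) _.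
rewrite -mulnA -expnMn leq_mul2l; apply/orP; right.
case: (D) => [|D']; first by rewrite !expn0.
by rewrite leq_exp2r //; nia.
Qed.

End Dimension.

(** * Lowest degree terms of K(1 - t) *)

Section LowestPart.

Variable d : nat.
Implicit Types (K : {freeg 'rV[int]_d / int}) (a b : 'rV[int]_d) (u : 'X_{1..d}).
Implicit Types (P : {mpoly int[d]}) (g : 'rV[int]_d -> int).

Definition lin_ext g K : int := \sum_(b <- dom K) coeff b K * g b.

HB.instance Definition _ (g : 'rV[int]_d -> int^o) :=
  GRing.isZmodMorphism.Build {freeg 'rV[int]_d / int} int^o (fglift g)
    (lift_is_additive g).

Lemma lin_ext_fglift g K : lin_ext g K = fglift (g : 'rV[int]_d -> int^o) K.
Proof.
rewrite -[K in RHS]freeg_sumE raddf_sum; apply: eq_bigr => b _.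
exact/esym/(@liftU _ int^o).
Qed.

Lemma lin_ext_additive g : zmod_morphism (lin_ext g).
Proof. by move=> K K'; rewrite !lin_ext_fglift raddfB. Qed.

HB.instance Definition _ g :=
  GRing.isZmodMorphism.Build {freeg 'rV[int]_d / int} int (lin_ext g) (lin_ext_additive g).

Lemma lin_extU g n b : lin_ext g << n *g b >> = n * g b.
Proof. by rewrite lin_ext_fglift liftU. Qed.

Lemma eq_lin_ext g g' K : g =1 g' -> lin_ext g K = lin_ext g' K.
Proof. by move=> h; apply: eq_bigr => b _; rewrite h. Qed.

Lemma lin_extB g g' K : lin_ext (fun b => g b - g' b) K = lin_ext g K - lin_ext g' K.
Proof. by rewrite -sumrB; apply: eq_bigr => b _; rewrite mulrBr. Qed.

(** Multiplication by t^a. *)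
Definition shiftK a K : {freeg 'rV[int]_d / int} :=
  \sum_(b <- dom K) << coeff b K *g a + b >>.

Lemma lin_ext_shiftK g a K : lin_ext g (shiftK a K) = lin_ext (fun b => g (a + b)) K.
Proof. by rewrite raddf_sum; apply: eq_bigr => b _ /=; rewrite lin_extU. Qed.

Definition pow1B_coefs u b : int := \prod_(j < d) pow1B_coef (b 0 j) (u j).

Lemma subst1B_coefE K u : subst1B_coef K u = lin_ext (pow1B_coefs u) K.
Proof. by []. Qed.

(** Coefficients of (1 - t)^(1 + e) = (1 - t)^e - t (1 - t)^e: Pascal's rule for either sign of the
    exponent, with the passage from -1 to 0 treated apart. *)
Lemma pow1B_coefS e n :
  pow1B_coef (1 + e) n = pow1B_coef e n - (if n is n'.+1 then pow1B_coef e n' else 0).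
Proof.
case: e => q.
  rewrite -[1 + Posz q]/(Posz q.+1) /pow1B_coef; case: n => [|n].
    by rewrite !bin0 subr0.
  by rewrite binS PoszD mulrDr exprS; ring.
case: q => [|q].
  rewrite -[1 + Negz 0]/(Posz 0) /pow1B_coef; case: n => [|n].
    by rewrite !bin0 subr0.
  by rewrite bin0n mulr0 !add0n !binn subrr.
have -> : 1 + Negz q.+1 = Negz q by rewrite !NegzE; lia.
rewrite /pow1B_coef; case: n => [|n]; first by rewrite !bin0 subr0.
by rewrite addSn binS PoszD !addSnnS addrK.
Qed.

Definition unit_degree (j : 'I_d) : 'rV[int]_d := delta_mx 0 j.

Lemma pow1B_coefs_unit u j b :
  pow1B_coefs u (unit_degree j + b) =
    pow1B_coefs u b - (if (0 < u j)%N then pow1B_coefs (u - U_(j))%MM b else 0).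
Proof.
have D v c : pow1B_coefs v c = pow1B_coef (c 0 j) (v j) *
    \prod_(i < d | i != j) pow1B_coef (c 0 i) (v i) by rewrite /pow1B_coefs (bigD1 j).
rewrite !D !mxE !eqxx /= pow1B_coefS.
have -> : \prod_(i < d | i != j) pow1B_coef ((delta_mx 0 j + b) 0 i) (u i) =
    \prod_(i < d | i != j) pow1B_coef (b 0 i) (u i).
  by apply: eq_bigr => i /negbTE ij; rewrite !mxE ij andbF add0r.
have -> : \prod_(i < d | i != j) pow1B_coef (b 0 i) ((u - U_(j))%MM i) =
    \prod_(i < d | i != j) pow1B_coef (b 0 i) (u i).
  by apply: eq_bigr => i /negbTE ij; rewrite mnmBE mnm1E eq_sym ij subn0.
by rewrite mnmBE mnm1E eqxx; case: (u j) => [|n] /=; rewrite ?subr0 // subn1 /= mulrBl.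
Qed.

(* [lowest K e P] says that [K(1 - t)] has no terms of degree less than [e] and
   that [P], possibly zero, is its part of degree [e]. *)
Definition lowest K (e : nat) P : Prop :=
  forall u, ((mdeg u < e)%N -> subst1B_coef K u = 0) /\
            P@_u = if mdeg u == e then subst1B_coef K u else 0.

Lemma lowestB K K' e P P' : lowest K e P -> lowest K' e P' ->
  lowest (K - K') e (P - P').
Proof.
move=> h h' u; have [h1 h2] := h u; have [h1' h2'] := h' u.
rewrite subst1B_coefE raddfB /= -!subst1B_coefE; split.
  by move=> lt; rewrite h1 // h1' // subrr.
by rewrite mcoeffB h2 h2'; case: ifP => // _; rewrite subrr.
Qed.

Lemma lowest0 e : lowest 0 e 0.
Proof.
move=> u; rewrite subst1B_coefE raddf0; split=> //.
by rewrite mcoeff0 if_same.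
Qed.

Lemma lowestD K K' e P P' : lowest K e P -> lowest K' e P' ->
  lowest (K + K') e (P + P').
Proof.
move=> h h'; rewrite -[K']opprK -[P']opprK -[- K']add0r -[- P']add0r.
by apply: lowestB => //; apply: lowestB => //; apply: lowest0.
Qed.

Lemma lowestW K e e' P : (e' < e)%N -> lowest K e P -> lowest K e' 0.
Proof.
move=> lt h u; have [h1 _] := h u; split=> [lt'|]; first by apply: h1; apply: ltn_trans lt.
by rewrite mcoeff0; case: eqP => // e1; rewrite h1 // e1.
Qed.

Lemma lowest_eq K K' e P : (forall u, subst1B_coef K u = subst1B_coef K' u) ->
  lowest K e P -> lowest K' e P.
Proof. by move=> h hK u; rewrite -h. Qed.

Lemma subst1B_coef_shiftD a b K u :
  subst1B_coef (shiftK (a + b) K) u = subst1B_coef (shiftK a (shiftK b K)) u.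
Proof.
by rewrite !subst1B_coefE !lin_ext_shiftK; apply: eq_lin_ext => c; rewrite addrA.
Qed.

Lemma subst1B_coef_shift_unit j K u :
  subst1B_coef (shiftK (unit_degree j) K) u =
    subst1B_coef K u - (if (0 < u j)%N then subst1B_coef K (u - U_(j))%MM else 0).
Proof.
rewrite !subst1B_coefE lin_ext_shiftK (eq_lin_ext _ (pow1B_coefs_unit u j)) lin_extB.
congr (_ - _); case: ifP => // _; rewrite /lin_ext big1 // => b _.
by rewrite mulr0.
Qed.

Lemma mcoeffMXU P j u :
  (P * 'X_j)@_u = if (0 < u j)%N then P@_(u - U_(j))%MM else 0.
Proof.
case: ifP => uj.
  rewrite -[u in LHS](@submK _ U_(j)%MM) 1?addmC ?mcoeffMX //.
  apply/mnm_lepP => i; rewrite mnm1E.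
  by case: (j =P i) => // <-.
apply/memN_msupp_eq0/negP; rewrite (perm_mem (msuppMX _ _)) => /mapP [v _ e].
by rewrite e mnmDE mnm1E eqxx in uj.
Qed.

Lemma mdeg_subU u j : (0 < u j)%N -> mdeg u = (mdeg (u - U_(j))%MM).+1.
Proof.
move=> uj; have le : (U_(j) <= u)%MM.
  by apply/mnm_lepP => i; rewrite mnm1E; case: (j =P i) => // <-.
by rewrite -{1}(submK le) mdegD mdeg1 addn1.
Qed.

Lemma lowest_unit K e P j : lowest K e P ->
  lowest (K - shiftK (unit_degree j) K) e.+1 (P * 'X_j).
Proof.
move=> h u; rewrite subst1B_coefE raddfB /= -!subst1B_coefE subst1B_coef_shift_unit subKr.
rewrite mcoeffMXU; case: ifP => uj; last by split=> //; rewrite if_same.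
rewrite (mdeg_subU uj) ltnS eqSS; exact: h.
Qed.

(** Multiplying by t^a subtracts [K - shiftK a K], which only starts in degree [e.+1]. *)
Lemma lowest_shift_of_sub K e P a P' :
  lowest K e P -> lowest (K - shiftK a K) e.+1 P' -> lowest (shiftK a K) e P.
Proof.
move=> h h'; rewrite -[shiftK a K](subKr K) -[P]subr0.
by apply: lowestB => //; apply: lowestW h'.
Qed.

(** Multiplying by the inverse of t_j becomes division by 1 - t_j. The recursion [eK], which reads
    K' = K + t_j K' after substitution, is solved by induction on the exponent of t_j. *)
Lemma lowest_shiftN_unit K e P j : lowest K e P ->
  lowest (shiftK (- unit_degree j) K) e P.
Proof.
move=> h; set K' := shiftK _ K.
have eK v : subst1B_coef K' v = subst1B_coef K v +
    (if (0 < v j)%N then subst1B_coef K' (v - U_(j))%MM else 0).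
  have := subst1B_coef_shift_unit j K' v.
  rewrite -subst1B_coef_shiftD subrr [X in X = _ - _](_ : _ = subst1B_coef K v).
    by move=> ->; rewrite subrK.
  rewrite !subst1B_coefE lin_ext_shiftK; apply: eq_lin_ext => b.
  by rewrite add0r.
have low v : (mdeg v < e)%N -> subst1B_coef K' v = 0.
  have [n] := ubnP (v j); elim: n v => // n IH v szv ve.
  rewrite eK (h v).1 // add0r; case: ifP => // vj; apply: IH.
    by rewrite mnmBE mnm1E eqxx; lia.
  by move: ve; rewrite (mdeg_subU vj); lia.
move=> u; split; first exact: low.
rewrite (h u).2; case: eqP => // ue; rewrite eK; case: ifP => uj; last by rewrite addr0.
by rewrite low ?addr0 // -ue (mdeg_subU uj).
Qed.

Lemma ordinary_weightD a b :
  ordinary_weight (a + b) = ordinary_weight a + ordinary_weight b.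
Proof. by rewrite -big_split; apply: eq_bigr => j _; rewrite mxE scalerDl. Qed.

Lemma ordinary_weightN a : ordinary_weight (- a) = - ordinary_weight a.
Proof. by rewrite -sumrN; apply: eq_bigr => j _; rewrite mxE scaleNr. Qed.

Lemma ordinary_weight_unit j : ordinary_weight (unit_degree j) = 'X_j.
Proof.
rewrite /ordinary_weight (bigD1 j) //= mxE !eqxx scale1r big1 ?addr0 //.
by move=> i /negbTE ij; rewrite mxE ij andbF scale0r.
Qed.

Definition lowest_mul a : Prop := forall K e P, lowest K e P ->
  lowest (K - shiftK a K) e.+1 (P * ordinary_weight a).

(** From 1 - t^(a + b) = (1 - t^b) + t^b (1 - t^a), where the factor t^b does not affect the lowest
    part. *)
Lemma lowest_mulD a b : lowest_mul a -> lowest_mul b -> lowest_mul (a + b).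
Proof.
move=> ha hb K e P h; have hK := lowest_shift_of_sub h (hb _ _ _ h).
have := lowestD (hb _ _ _ h) (ha _ _ _ hK).
rewrite -mulrDr -ordinary_weightD [b + a]addrC. move=> h1; apply: (lowest_eq _ h1) => u.
rewrite !(subst1B_coefE, raddfB, raddfD) /= -!subst1B_coefE subst1B_coef_shiftD.
by rewrite addrA subrK.
Qed.

Lemma lowest_mul_unit j : lowest_mul (unit_degree j).
Proof. by move=> K e P h; rewrite ordinary_weight_unit; apply: lowest_unit. Qed.

Lemma lowest_mul0 : lowest_mul 0.
Proof.
move=> K e P h; have -> : P * ordinary_weight 0 = 0.
  by rewrite /ordinary_weight big1 ?mulr0 // => j _; rewrite mxE scale0r.
apply: (lowest_eq _ (lowest0 _)) => u.
rewrite !(subst1B_coefE, raddfB, raddf0) /= lin_ext_shiftK.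
by rewrite (eq_lin_ext (g' := pow1B_coefs u)) ?subrr // => b; rewrite add0r.
Qed.

(** From 1 - t_j^(-1) = - t_j^(-1) (1 - t_j). *)
Lemma lowest_mulN_unit j : lowest_mul (- unit_degree j).
Proof.
move=> K e P h; have h' := lowest_shiftN_unit j h.
have := lowestB (lowest0 _) (lowest_mul_unit j h').
rewrite !sub0r -mulrN -ordinary_weightN => h1; apply: (lowest_eq _ h1) => u.
rewrite !(subst1B_coefE, raddfB, raddfN) /= -!subst1B_coefE -subst1B_coef_shiftD.
rewrite opprK addrC; congr (_ - _).
rewrite !subst1B_coefE lin_ext_shiftK; apply: eq_lin_ext => b.
by rewrite subrr add0r.
Qed.

(* The additive group of degrees is generated by the unit degrees, for which
   multiplying [K] by [1 - t_j] is multiplying [K(1 - t)] by [t_j]. *)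
Lemma lowest_mul_all a : lowest_mul a.
Proof.
have hZ j (z : int) : lowest_mul (z *: unit_degree j).
  elim/int_ind: z => [|n IH|n IH].
  - by rewrite scale0r; apply: lowest_mul0.
  - rewrite intS scalerDl scale1r; apply: lowest_mulD => //.
    exact: lowest_mul_unit.
  - rewrite intS opprD scalerDl scaleN1r; apply: lowest_mulD => //.
    exact: lowest_mulN_unit.
have -> : a = \sum_j a 0 j *: unit_degree j by rewrite {1}[a]row_sum_delta.
elim/big_ind: _ => [||j _]; [exact: lowest_mul0 | exact: lowest_mulD | exact: hZ].
Qed.

Lemma lowest_subst1B_part K e P : lowest K e P -> subst1B_part K e = P.
Proof.
move=> h; apply/mpolyP => u; rewrite (h u).2 /subst1B_part raddf_sum /=.
under eq_bigr do rewrite mcoeffZ mcoeffX.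
case: eqP => [ue|ue]; last first.
  rewrite big1 // => v /eqP ve; case: eqP => [vu|]; rewrite ?mulr0 //.
  by rewrite vu in ve.
have lt : (mdeg u < e.+1)%N by rewrite ue.
rewrite (bigD1 (BMultinom lt)) /= ?ue // eqxx mulr1 big1 ?addr0 // => v /andP [_ ne].
case: eqP => [vu|]; rewrite ?mulr0 //; case/eqP: ne; exact: val_inj.
Qed.

(** Since [lowest] tolerates [P = 0], it is the nonvanishing of [P] that makes [e] the least
    degree. *)
Lemma lowest_partE K e P : lowest K e P -> P != 0 -> lowest_part K = P.
Proof.
move=> h P0; have hP := lowest_subst1B_part h; rewrite /lowest_part.
case: excluded_middle_informative => [ex|[]]; last by exists e; rewrite hP.
case: ex_minnP => n n0 nmin; suff -> : n = e by [].
apply/eqP; rewrite eqn_leq nmin ?hP //= leqNgt; apply/negP => /lowestW/(_ h) h0.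
by rewrite (lowest_subst1B_part h0) eqxx in n0.
Qed.

End LowestPart.

(** * Positive gradings and Hilbert series *)

Section Gordan.

Variable d : nat.
Implicit Types (u v l : 'rV[int]_d).

Definition dot u v : int := \sum_j u 0 j * v 0 j.

Lemma dotC u v : dot u v = dot v u.
Proof. by apply: eq_bigr => j _; rewrite mulrC. Qed.

Lemma dotDl u v l : dot (u + v) l = dot u l + dot v l.
Proof. by rewrite -big_split; apply: eq_bigr => j _; rewrite mxE mulrDl. Qed.

Lemma dotZl c u l : dot (c *: u) l = c * dot u l.
Proof. by rewrite mulr_sumr; apply: eq_bigr => j _; rewrite mxE mulrA. Qed.

Lemma dotNl u l : dot (- u) l = - dot u l.
Proof. by rewrite -scaleN1r dotZl mulN1r. Qed.

Lemma dotBl u v l : dot (u - v) l = dot u l - dot v l.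
Proof. by rewrite dotDl dotNl. Qed.

Lemma dot0l l : dot 0 l = 0.
Proof. by rewrite -(scale0r 0) dotZl mul0r. Qed.

Lemma dotMnl u n l : dot (u *+ n) l = dot u l *+ n.
Proof. by elim: n => [|n IH]; rewrite ?mulr0n ?dot0l // !mulrS dotDl IH. Qed.

Lemma dot_suml (I : Type) (s : seq I) (F : I -> 'rV[int]_d) l :
  dot (\sum_(i <- s) F i) l = \sum_(i <- s) dot (F i) l.
Proof. by elim/big_rec2: _ => [|i x y _ <-]; rewrite ?dot0l ?dotDl. Qed.

Lemma dot_gt0 u : u != 0 -> 0 < dot u u.
Proof.
move=> u0; rewrite lt_def sumr_ge0 ?andbT; last by move=> j _; rewrite -expr2 sqr_ge0.
apply: contraNneq u0 => /psumr_eq0P h; apply/eqP/rowP => j; rewrite mxE.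
by apply/eqP; rewrite -sqrf_eq0 expr2 h // => i _; rewrite -expr2 sqr_ge0.
Qed.

(* Gordan's alternative, by induction on the number of vectors: project all of
   them onto the orthogonal complement of the first. *)
Lemma gordan n (a : 'I_n -> 'rV[int]_d) :
  (exists l, forall i, 0 < dot (a i) l) \/
  (exists c : 'I_n -> nat, (exists i, c i != 0%N) /\ \sum_i a i *+ c i = 0).
Proof.
elim: n a => [|n IH] a; first by left; exists 0 => -[].
set b := a ord0; pose a' i := a (fintype.lift ord0 i); set N := dot b b.
pose ext (x : nat) (c : 'I_n -> nat) j := if unlift ord0 j is Some i then c i else x.
have ext0 x c : ext x c ord0 = x by rewrite /ext unlift_none.
have extS x c i : ext x c (fintype.lift ord0 i) = c i by rewrite /ext liftK.
have sum_ext x c : \sum_i a i *+ ext x c i = b *+ x + \sum_i a' i *+ c i.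
  by rewrite big_ord_recl ext0; congr (_ + _); apply: eq_bigr => i _; rewrite extS.
have [b0|b0] := eqVneq b 0.
  right; exists (ext 1%N (fun _ => 0%N)); split; first by exists ord0; rewrite ext0.
  by rewrite sum_ext b0 mul0rn add0r big1.
have N0 : 0 < N by apply: dot_gt0.
(* The projections orthogonal to [b], multiplied by [N] to stay integral. *)
have [[l hl]|[c [[i0 ci0] hc]]] := IH (fun i => N *: a' i - dot (a' i) b *: b).
  left; pose p := N *: l - dot l b *: b.
  have bp : dot b p = 0.
    by rewrite dotC dotBl !dotZl -/N mulrC subrr.
  have ap i : 0 < dot (a' i) p.
    have := hl i; rewrite dotBl !dotZl [dot (a' i) p]dotC dotBl !dotZl.
    by rewrite [dot l (a' i)]dotC [dot b l]dotC [dot b (a' i)]dotC [_ * dot l b]mulrC.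
  (* The vector [p] is orthogonal to [b] and pairs to at least 1 with each [a' i], so [T *: p]
     outweighs the pairings of [b] with the [a' i]. *)
  pose T := 1 + \sum_i `|dot (a' i) b|.
  exists (T *: p + b) => j; rewrite dotC dotDl dotZl ![dot _ (a j)]dotC.
  case: (unliftP ord0 j) => [i ->|->]; last by rewrite bp mulr0 add0r.
  have hT : `|dot (a' i) b| < T.
    rewrite /T (bigD1 i) //= addrCA ltrDl ltr_wpDr //.
    by apply: sumr_ge0 => ? _; apply: normr_ge0.
  have T0 : 0 <= T by apply: le_trans (ltW hT).
  have : T <= T * dot (a' i) p by rewrite ler_peMr // -gtz0_ge1.
  rewrite -/(a' i); move: hT; case: (ltrgt0P (dot (a' i) b)); lia.
(* A relation among the projections makes [\sum_i a' i *+ c i] equal to [g / N] times [b]. If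
   [g <= 0], this is a relation among the [a i]. If [g > 0], any [l] positive on the [a' i] is
   positive on [b], and the induction hypothesis is applied to [a'] itself. *)
pose g := \sum_i (dot (a' i) b) *+ c i.
have hg : (\sum_i a' i *+ c i) *+ `|N|%N = g *: b.
  apply/eqP; rewrite -subr_eq0; apply/eqP; rewrite -[RHS]hc.
  rewrite -scaler_nat natz gtz0_abs // scaler_sumr scaler_suml -sumrB.
  by apply: eq_bigr => i _; rewrite mulrnBl scalerMnr scalerMnl.
have [g0|g0] := lerP g 0.
  right; exists (ext `|g|%N (fun i => c i * `|N|)%N); split.
    by exists (fintype.lift ord0 i0); rewrite extS muln_eq0 negb_or ci0; lia.
  rewrite sum_ext; under eq_bigr do rewrite mulrnA.
  rewrite sumrMnl hg -scaler_nat natz -scalerDl.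
  by rewrite (_ : `|g|%N%:Z + g = 0) ?scale0r //; lia.
have [[l hl]|[c' [[i1 ci1] hc']]] := IH a'; last first.
  right; exists (ext 0%N c'); split; last by rewrite sum_ext hc' mulr0n add0r.
  by exists (fintype.lift ord0 i1); rewrite extS.
left; exists l => j; case: (unliftP ord0 j) => [i ->|->]; first exact: hl.
have := congr1 (fun v => dot v l) hg; rewrite dotMnl dotZl dot_suml => e.
rewrite -(pmulr_rgt0 _ g0) -e pmulrn_lgt0 ?absz_gt0 ?gt_eqF //.
rewrite (bigD1 i0) //= dotMnl ltr_pwDl ?pmulrn_lgt0 ?lt0n //.
by apply: sumr_ge0 => i _; rewrite dotMnl mulrn_wge0 // ltW.
Qed.

End Gordan.

(** * Monomials of a given degree and Hilbert series *)

Section Degrees.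

Variables (m d : nat) (a : 'I_m -> 'rV[int]_d).
Implicit Types (u v : 'X_{1..m}) (b c : 'rV[int]_d).

Lemma wdegD u v : wdeg a (u + v)%MM = wdeg a u + wdeg a v.
Proof. by rewrite /wdeg -big_split; apply: eq_bigr => i _; rewrite mnmDE mulrnDr. Qed.

Lemma wdeg0 : wdeg a 0%MM = 0.
Proof. by rewrite /wdeg big1 // => i _; rewrite mnm0E. Qed.

Lemma wdeg1 i : wdeg a U_(i)%MM = a i.
Proof.
rewrite /wdeg (bigD1 i) //= mnm1E eqxx mulr1n big1 ?addr0 // => j /negbTE ji.
by rewrite mnm1E eq_sym ji.
Qed.

Lemma wdegMn u n : wdeg a (u *+ n)%MM = wdeg a u *+ n.
Proof. by rewrite /wdeg -sumrMnl; apply: eq_bigr => i _; rewrite mulmnE mulrnA. Qed.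

(** By Gordan's alternative, some nontrivial monomial would otherwise have degree 0, and its powers
    would be infinitely many independent elements of that degree. *)
Lemma positive_half_space (k : fieldType) : positively_graded k a ->
  exists l, forall i, 0 < dot (a i) l.
Proof.
move=> pos; have [//|[c [[i ci] hc]]] := gordan a.
pose u := [multinom c i | i < m].
have wu n : wdeg a (u *+ n)%MM = 0.
  rewrite wdegMn (_ : wdeg a u = 0) ?mul0rn // -[RHS]hc.
  by apply: eq_bigr => j _; rewrite mnmE.
have [s hs] := pos 0.
suff : ((size s).+1 <= size s)%N by rewrite ltnn.
rewrite -[X in (X <= _)%N](size_iota 0) -[X in (_ <= X)%N]size_enum_ord.
apply: (@indep_leq_spans k k (kidl k) {mpoly k[m]} (homogeneous_poly a 0)
  (fun f => f = 0) _ _ _ (fun n => 'X_[u *+ n]) _ (fun i : 'I_(size s) => s`_i)).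
- by split=> // e f g -> ->; rewrite scaler0 addr0.
- exact: iota_uniq.
- by move=> n _ v; rewrite msuppX inE => /eqP ->.
- move=> e; move: (iota 0 _) (iota_uniq 0 (size s).+1) => t ut he n ns.
  have := congr1 (mcoeff (u *+ n)%MM) he.
  rewrite mcoeff0 raddf_sum /= (bigD1_seq n) //= mcoeffZ mcoeffX eqxx mulr1.
  rewrite big1 ?addr0 // => n' nn'; rewrite mcoeffZ mcoeffX.
  case: eqP => [e'|]; rewrite ?mulr0 //; case/negP: nn'.
  have := congr1 (fun v : 'X_{1..m} => v i) e'; rewrite !mulmnE mnmE => /eqP.
  by rewrite eqn_mul2l (negbTE ci).
- move=> f /hs [e ->]; exists e; rewrite /lincomb big_enum /=; exact: subrr.
Qed.

Variable l : 'rV[int]_d.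
Hypothesis a_gt0 : forall i, 0 < dot (a i) l.

Definition height i : nat := `|dot (a i) l|%N.

Lemma height_gt0 i : (0 < height i)%N.
Proof. by rewrite absz_gt0 gt_eqF. Qed.

Lemma dot_wdeg u : dot (wdeg a u) l = (wt height u)%:Z.
Proof.
rewrite /wdeg dot_suml /wt; elim/big_rec2: _ => // i n x _ ->.
by rewrite PoszD PoszM dotMnl /height gtz0_abs // -mulr_natl natz.
Qed.

Implicit Types (S : {set 'I_m}).

(* All the monomials of degree [c] in the variables indexed by [S]: the height
   of [c] bounds their exponents. *)
Definition parts S c : seq 'X_{1..m} :=
  [seq u <- box_points `|dot c l|%N 0%MM S | wdeg a u == c].

Lemma mem_parts S c u : (u \in parts S c) = box 0%MM S u && (wdeg a u == c).
Proof.
rewrite mem_filter andbC; case: eqP => [<-|_]; rewrite ?andbF // !andbT.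
rewrite dot_wdeg absz_nat; apply/idP/idP; first exact: box_points_box.
by move/mem_box_points; apply; [exact: height_gt0|].
Qed.

Lemma uniq_parts S c : uniq (parts S c).
Proof. by rewrite filter_uniq // uniq_box_points. Qed.

(* The vector partition function of [a]. *)
Definition vpf S c : nat := size (parts S c).

Lemma count_box_parts v S c : count (box v S) (parts setT c) = vpf S (c - wdeg a v).
Proof.
rewrite -size_filter /vpf -[RHS](size_map (fun u => v + u)%MM).
apply/perm_size/uniq_perm; first by rewrite filter_uniq // uniq_parts.
  rewrite map_inj_uniq ?uniq_parts // => u u' /mnmP h; apply/mnmP => i.
  by have := h i; rewrite !mnmDE => /addnI.
move=> u; rewrite mem_filter mem_parts; apply/andP/mapP => [[vu /andP [_ /eqP e]]|].
  exists (u - v)%MM; last by rewrite addmC submK // (box_lem vu).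
  have := wdegD (u - v)%MM v; rewrite submK ?(box_lem vu) // => eu.
  rewrite mem_parts -e eu addrK eqxx andbT.
  apply/box0P => i iS; have /boxP/(_ i) := vu.
  by rewrite (negbTE iS) mnmBE => /eqP ->; rewrite subnn.
move=> [u']; rewrite mem_parts => /andP [/box0P h /eqP e] ->; split; last first.
  by rewrite wdegD e addrC subrK eqxx andbT; apply/box0P => i; rewrite inE.
apply/boxP => i; case: (boolP (i \in S)) => iS; rewrite mnmDE ?leq_addr //.
by rewrite h // addn0.
Qed.

Lemma count_parts (D : pred 'X_{1..m}) (L : seq ('X_{1..m} * {set 'I_m})) c :
  (forall u, count (fun x => box x.1 x.2 u) L = D u) ->
  count D (parts setT c) = (\sum_(x <- L) vpf x.2 (c - wdeg a x.1))%N.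
Proof.
move=> hL; under eq_bigr do rewrite -count_box_parts.
elim: (parts setT c) => [|u s IH] /=; first by rewrite big1_eq.
rewrite big_split -IH -hL /=; congr addn.
by elim: L {hL IH} => [|x L IH]; rewrite ?big_nil ?big_cons //= IH.
Qed.

(** A monomial in [z_S] either avoids [z_i] or is divisible by it. *)
Lemma vpf_split S i c : i \in S -> vpf S c = (vpf (S :\ i) c + vpf S (c - a i))%N.
Proof.
move=> iS; rewrite -[c in vpf S c]subr0 -[c in vpf (S :\ i) c]subr0 -wdeg0.
rewrite -(wdeg1 i) -[U_(i)%MM]add0m -!count_box_parts.
elim: (parts setT c) => //= u s ->; rewrite (box_split 0%MM u iS).
exact: addnACA.
Qed.

Lemma vpf0 S : vpf S 0 = 1%N.
Proof.
have : parts S 0 =i [:: 0%MM].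
  move=> u; rewrite mem_parts inE; apply/andP/eqP => [[_ /eqP e]|->]; last first.
    by split; [exact: box_refl | rewrite wdeg0].
  have := dot_wdeg u; rewrite e dot0l => -[/esym h]; apply/mnmP => i.
  by have := leq_wt height_gt0 u i; rewrite h leqn0 mnm0E => /eqP.
by move=> h; rewrite /vpf (perm_size (uniq_perm (uniq_parts _ _) _ h)).
Qed.

Lemma vpf_neq0 S c : vpf S c != 0%N -> 0 <= dot c l.
Proof.
rewrite -lt0n -has_predT => /hasP [u]; rewrite mem_parts => /andP [_ /eqP <-] _.
by rewrite dot_wdeg.
Qed.

Lemma vpf_eq0 S c : dot c l = 0 -> c != 0 -> vpf S c = 0%N.
Proof.
move=> c0 cn0; apply/eqP; rewrite -leqn0 leqNgt -has_predT; apply/hasP => -[u].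
rewrite mem_parts => /andP [_ /eqP e] _; case/eqP: cn0.
move: c0; rewrite -e dot_wdeg => -[h]; rewrite (_ : u = 0%MM) ?wdeg0 //.
by apply/mnmP => i; have := leq_wt height_gt0 u i; rewrite h leqn0 mnm0E => /eqP.
Qed.

(* The coefficients of the Hilbert series [K / \prod_i (1 - t^(a i))]. *)
Definition hilbert (K : {freeg 'rV[int]_d / int}) c : int :=
  lin_ext (fun b => (vpf setT (c - b))%:Z) K.

(** At an element [c] of the support of the difference that is lowest along [l], only the term of
    [c] itself contributes to the Hilbert function. *)
Lemma hilbert_inj K K' : (forall c, hilbert K c = hilbert K' c) -> K = K'.
Proof.
move=> h; apply/eqP; rewrite -subr_eq0 -dom_eq0.
have {}h c : lin_ext (fun b => (vpf setT (c - b))%:Z) (K - K') = 0.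
  by rewrite raddfB /= -/(hilbert K c) h subrr.
apply/negP => /negP; move: (K - K') h => {K K'}K h.
case e : (dom K) => [//|b0 s] _.
have [c cK cmin] : exists2 c, c \in dom K & {in dom K, forall b, dot c l <= dot b l}.
  rewrite e; elim: s b0 {e} => [|b s IH] b0.
    by exists b0 => [|b]; rewrite inE // => /eqP ->.
  have [c cs hc] := IH b; have [le|lt] := lerP (dot c l) (dot b0 l).
    by exists c => [|b']; rewrite inE ?cs ?orbT // => /orP [/eqP ->|/hc].
  exists b0 => [|b']; rewrite inE ?eqxx // => /orP [/eqP ->//|/hc].
  exact/le_trans/ltW.
have := h c; rewrite /lin_ext (bigD1_seq c) ?uniq_dom //= subrr vpf0 mulr1.
rewrite big_seq_cond big1 ?addr0 => [/eqP|b /andP [bK bc]].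
  by rewrite mem_dom in cK; rewrite (negbTE cK).
suff -> : vpf setT (c - b) = 0%N by rewrite mulr0.
apply/eqP; apply: contraT => hv; have := vpf_neq0 hv; rewrite dotBl subr_ge0 => le.
case/negP: hv; apply/eqP/vpf_eq0; last by rewrite subr_eq0 eq_sym.
by apply/eqP; rewrite dotBl subr_eq0 eq_le le cmin.
Qed.

(* [t^b] times the product of the [1 - t^(a i)], [i] in [s]. *)
Definition box_K b (s : seq 'I_m) : {freeg 'rV[int]_d / int} :=
  foldr (fun i K => K - shiftK (a i) K) << b >> s.

(** By [vpf_split], each factor 1 - t^(a i) removes the variable [i] from the partition function. *)
Lemma hilbert_box_K b s c : uniq s ->
  hilbert (box_K b s) c = vpf (~: [set i in s]) (c - b).
Proof.
elim: s c => [|i s IH] c /=.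
  move=> _; rewrite /hilbert lin_extU mul1r (_ : ~: _ = setT) //.
  by apply/setP => i; rewrite !inE.
move=> /andP [si us]; rewrite /hilbert raddfB /= -/(hilbert _ c) lin_ext_shiftK IH //.
under [X in _ - X]eq_lin_ext do rewrite opprD addrA.
rewrite -/(hilbert _ (c - a i)) IH // (@vpf_split _ i); last by rewrite !inE.
rewrite PoszD [c - a i - b]addrAC addrK; congr (Posz (vpf _ _)).
by apply/setP => j; rewrite !inE negb_or.
Qed.

Lemma lowest_box_K b s :
  lowest (box_K b s) (size s) (\prod_(i <- s) ordinary_weight (a i)).
Proof.
elim: s => [|i s IH] /=; last first.
  by rewrite big_cons mulrC; apply: lowest_mul_all.
move=> u; rewrite big_nil subst1B_coefE lin_extU mul1r; split=> //.
rewrite mcoeff1 mdeg_eq0; case: eqP => // ->.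
rewrite /pow1B_coefs big1 // => j _; rewrite mnm0E /pow1B_coef.
by case: (b 0 j) => q; rewrite bin0.
Qed.

End Degrees.

(** * Graded submodules and resolutions *)

Section GradedSubmodules.

Variables (k : fieldType) (m d : nat) (a : 'I_m -> 'rV[int]_d).
Local Notation R := {mpoly k[m]}.

Lemma eq_filt (Q Q' : pred 'X_{1..m}) (f : R) : Q =1 Q' -> filt Q f = filt Q' f.
Proof. by move=> h; apply/mpolyP => u; rewrite !mcoeff_filt h. Qed.

Section Shifts.

Variables (n : nat) (b : 'I_n -> 'rV[int]_d).
Implicit Types (v w : 'rV[R]_n) (Q : pred 'rV[int]_d) (N : 'rV[R]_n -> Prop).

Definition hfilt Q v : 'rV[R]_n := \row_j filt (fun u => Q (wdeg a u + b j)) (v 0 j).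

Lemma mcoeff_hfilt Q v j u :
  (hfilt Q v 0 j)@_u = if Q (wdeg a u + b j) then (v 0 j)@_u else 0.
Proof. by rewrite mxE mcoeff_filt. Qed.

Lemma hfilt_is_zmod_morphism Q : zmod_morphism (hfilt Q).
Proof. by move=> v w; apply/rowP => j; rewrite !mxE raddfB. Qed.

HB.instance Definition _ Q :=
  GRing.isZmodMorphism.Build 'rV[R]_n 'rV[R]_n (hfilt Q) (hfilt_is_zmod_morphism Q).

Lemma hfilt_homog Q c v : free_homog a b c v -> hfilt Q v = if Q c then v else 0.
Proof.
move=> h; apply/rowP => j; apply/mpolyP => u; rewrite mcoeff_hfilt.
have [uv|uv] := boolP (u \in msupp (v 0 j)).
  by rewrite (h j u uv) subrK; case: ifP; rewrite // mxE mcoeff0.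
by rewrite memN_msupp_eq0 // if_same; case: ifP; rewrite ?mxE ?mcoeff0 // memN_msupp_eq0.
Qed.

Lemma free_homog_hfilt c v : free_homog a b c (hfilt (pred1 c) v).
Proof.
by move=> j u; rewrite mxE msupp_filt => /andP [_ /= /eqP <-]; rewrite addrK.
Qed.

Lemma free_homogB c v w : free_homog a b c v -> free_homog a b c w ->
  free_homog a b c (v - w).
Proof.
move=> hv hw j u; rewrite !mxE => /msuppB_le; rewrite mem_cat.
by move=> /orP [/hv|/hw].
Qed.

Lemma free_homogZ c (x : k) v : free_homog a b c v -> free_homog a b c (x%:MP *: v).
Proof. by move=> hv j u; rewrite !mxE mul_mpolyC => /msuppZ_le /hv. Qed.

Lemma free_homog0 c : free_homog a b c (0 : 'rV[R]_n).
Proof. by move=> j u; rewrite mxE msupp0. Qed.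

Lemma hfilt_decomposition v : exists s : seq 'rV[int]_d, uniq s /\
  forall Q, hfilt Q v = \sum_(c <- s | Q c) hfilt (pred1 c) v.
Proof.
pose s := undup (flatten [seq [seq wdeg a u + b j | u <- msupp (v 0 j)] | j <- enum 'I_n]).
exists s; split=> [|Q]; first exact: undup_uniq.
apply/rowP => j; apply/mpolyP => u; rewrite mcoeff_hfilt summxE raddf_sum /=.
under eq_bigr do rewrite mcoeff_hfilt /=.
have [uv|uv] := boolP (u \in msupp (v 0 j)); last first.
  by rewrite memN_msupp_eq0 // if_same big1 // => c _; rewrite if_same.
have hs : wdeg a u + b j \in s.
  rewrite mem_undup; apply/flattenP; exists [seq wdeg a u' + b j | u' <- msupp (v 0 j)].
    by apply: map_f; rewrite mem_enum.
  by apply: (map_f (fun u' => wdeg a u' + b j)).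
rewrite big_mkcond (bigD1_seq _ hs (undup_uniq _)) /= eqxx big1 ?addr0 //.
by move=> c /negbTE; rewrite eq_sym => ->; rewrite if_same.
Qed.

Definition submodule N : Prop := N 0 /\ forall (c : R) v w, N v -> N w -> N (c *: v + w).

Definition hgraded N : Prop := forall Q v, N v -> N (hfilt Q v).

Lemma submoduleD N v w : submodule N -> N v -> N w -> N (v + w).
Proof. by case=> _ h nv nw; rewrite -[v]scale1r; apply: h. Qed.

Lemma submoduleZ N c v : submodule N -> N v -> N (c *: v).
Proof. by case=> h0 h nv; rewrite -[_ *: _]addr0; apply: h. Qed.

(* The submodule [N] is filtered by the index of the first nonzero coordinate;
   the leading coordinates at index [j] form the ideal [coord_ideal N j]. *)
Definition coord_ideal N (j : 'I_n) : R -> Prop :=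
  fun g => exists v, [/\ N v, forall i : 'I_n, (i < j)%N -> v 0 i = 0 & v 0 j = g].

Lemma ideal_coord_ideal N j : submodule N -> ideal (coord_ideal N j).
Proof.
move=> [N0 hN]; split; first by exists 0; split=> // *; rewrite mxE.
move=> c _ _ [v [nv v0 <-]] [w [nw w0 <-]]; exists (c *: v + w); split.
- exact: hN.
- by move=> i ij; rewrite !mxE v0 // w0 // mulr0 addr0.
- by rewrite !mxE.
Qed.

Lemma graded_coord_ideal N j Q f : hgraded N -> coord_ideal N j f ->
  coord_ideal N j (filt (fun u => Q (wdeg a u)) f).
Proof.
move=> gN [v [nv v0 <-]]; exists (hfilt (fun c => Q (c - b j)) v); split.
- exact: gN.
- by move=> i ij; rewrite mxE v0 // raddf0.
- by rewrite mxE; apply: eq_filt => u; rewrite addrK.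
Qed.

Definition free_index (t : 'I_n -> seq 'X_{1..m}) : seq ('I_n * 'X_{1..m}) :=
  [seq (j, u) | j <- enum 'I_n, u <- t j].

Definition free_monomial (x : 'I_n * 'X_{1..m}) : 'rV[R]_n := 'X_[x.2] *: delta_mx 0 x.1.

Local Notation kC := (@mpolyC m k : {rmorphism k -> R}).

Lemma lincomb_free t c j :
  lincomb kC (free_index t) free_monomial c 0 j = \sum_(u <- t j) c (j, u) *: 'X_[u].
Proof.
rewrite /lincomb big_allpairs_dep summxE (bigD1_seq j) ?mem_enum ?enum_uniq //=.
rewrite [X in _ + X]big1 ?addr0 => [|i /negbTE ij].
  rewrite summxE; apply: eq_bigr => u _.
  by rewrite !mxE !eqxx mulr1 mul_mpolyC.
rewrite summxE big1 // => u _.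
by rewrite !mxE /= eq_sym ij !mulr0.
Qed.

Lemma uniq_free_index t : (forall j, uniq (t j)) -> uniq (free_index t).
Proof.
move=> ut; apply: allpairs_uniq_dep => //; first exact: enum_uniq.
by move=> [j u] [j' u'] _ _ [-> ->].
Qed.

Lemma ksubspace_submodule N : submodule N -> ksubspace kC N.
Proof. by case=> N0 hN; split=> // c; apply: hN. Qed.

Lemma ksubspace_free_homog c : ksubspace kC (free_homog a b c).
Proof.
split=> [|x v w hv hw]; first exact: free_homog0.
rewrite -[w]opprK; apply: free_homogB; first exact: free_homogZ.
by rewrite -sub0r; apply: free_homogB => //; apply: free_homog0.
Qed.

Lemma homogeneous_division (J : R -> Prop) c f : ideal J ->
  (forall Q g, J g -> J (filt (fun u => Q (wdeg a u)) g)) -> homogeneous_poly a c f ->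
  exists g, [/\ J (f - g), homogeneous_poly a c g & {in msupp g, forall u, std J u}].
Proof.
move=> hJ gJ hf; have [g jg sg] := ideal_division f hJ.
exists (filt (fun u => wdeg a u == c) g); split.
- have := gJ (pred1 c) _ jg; rewrite raddfB /= [X in X - _]filt_id //.
  by move=> u /hf /eqP.
- by move=> u; rewrite msupp_filt => /andP [_ /eqP].
- by move=> u; rewrite msupp_filt => /andP [/sg].
Qed.

Variable l : 'rV[int]_d.
Hypothesis a_gt0 : forall i, 0 < dot (a i) l.

Definition std_parts N c j : seq 'X_{1..m} :=
  [seq u <- parts a l setT (c - b j) | std (coord_ideal N j) u].

Lemma mem_std_parts N c j u :
  (u \in std_parts N c j) = std (coord_ideal N j) u && (wdeg a u == c - b j).
Proof.
rewrite mem_filter mem_parts //; congr (_ && _).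
by rewrite (introT (box0P _ _)) // => i; rewrite inE.
Qed.

Lemma uniq_std_parts N c j : uniq (std_parts N c j).
Proof. by rewrite filter_uniq // uniq_parts. Qed.

(** The basis consists of the monomials, in each coordinate [j], that are standard for the [j]-th
    coordinate ideal. *)
Lemma qdim_std N c : submodule N -> hgraded N ->
  qdim kC (free_homog a b c) N
    (\sum_j count (std (coord_ideal N j)) (parts a l setT (c - b j)))%N.
Proof.
move=> hN gN; have uI j := uniq_std_parts N c j.
exists ('I_n * 'X_{1..m})%type, (free_index (std_parts N c)), free_monomial; split.
- exact: uniq_free_index.
- rewrite size_allpairs_dep sumnE big_map big_enum /=.
  by apply: eq_bigr => j _; rewrite size_filter.
- move=> _ /allpairsPdep [j [u [_ ut ->]]] i v; rewrite !mxE /=.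
  case: eqP => [->|_]; last by rewrite mulr0 msupp0.
  rewrite mulr1 msuppX inE => /eqP ->.
  by move: ut; rewrite mem_std_parts => /andP [_ /eqP].
- move=> e Ne.
  suff h (j : 'I_n) : {in std_parts N c j, forall u, e (j, u) = 0}.
    by move=> _ /allpairsPdep [j [u [_ ut ->]]]; apply: h.
  (* Once the coefficients before [j] vanish, coordinate [j] of the relation lies in the coordinate
     ideal and is made of standard monomials. *)
  have [p] := ubnP j; elim: p j => // p IH j jp u ut.
  have := mcoeff_sumX (fun u => e (j, u)) u (uI j); rewrite ut => <-.
  suff -> : \sum_(v <- std_parts N c j) e (j, v) *: 'X_[v] = 0 by rewrite mcoeff0.
  apply: (@std_indep _ _ (coord_ideal N j)) => [v|].
    rewrite mcoeff_msupp mcoeff_sumX //; case: ifP; last by rewrite eqxx.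
    by rewrite mem_std_parts => /andP [].
  eexists; split; [exact: Ne | | exact: lincomb_free].
  move=> i ij; rewrite lincomb_free big_seq big1 // => v vt.
  by rewrite IH ?scale0r //; apply: leq_trans ij _.
(* Spanning clears the coordinates from the first on: the vectors left to treat are supported in the
   last [p] coordinates. *)
suff key p v : (p <= n)%N -> free_homog a b c v ->
    (forall i : 'I_n, (i < n - p)%N -> v 0 i = 0) ->
    exists e, N (v - lincomb kC (free_index (std_parts N c)) free_monomial e).
  by move=> v hv; apply: (key n) => // i; rewrite subnn.
elim: p v => [|p IH] v pn hv v0.
  exists (fun _ => 0); rewrite (_ : v = 0).
    rewrite sub0r /lincomb big1 ?oppr0; first by case: hN.
    by move=> x _; rewrite rmorph0 scale0r.
  by apply/rowP => i; rewrite v0 ?mxE // subn0.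
have jn : (n - p.+1 < n)%N by lia.
pose j := Ordinal jn.
have [g [[w' [nw' w0' ew']] hg sg]] := homogeneous_division (ideal_coord_ideal j hN)
  (fun Q f => @graded_coord_ideal N j Q f gN) (hv j).
(* The degree [c] part of [w'] keeps its coordinate [j], which is already homogeneous. *)
have [w [nw hw ew w0]] : exists w, [/\ N w, free_homog a b c w, w 0 j = v 0 j - g
    & forall i : 'I_n, (i < j)%N -> w 0 i = 0].
  exists (hfilt (pred1 c) w'); split.
  - exact: gN.
  - exact: free_homog_hfilt.
  - rewrite mxE ew' filt_id // => u /msuppB_le; rewrite mem_cat /= => h.
    by have -> : wdeg a u = c - b j; [case/orP: h => [/hv|/hg] | rewrite subrK].
  - by move=> i ij; rewrite mxE w0' // raddf0.
have [|||e he] := IH (v - w - g *: delta_mx 0 j).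
- exact: ltnW.
- apply: free_homogB; first exact: free_homogB.
  move=> i u; rewrite !mxE /=; case: eqP => [->|_]; last by rewrite mulr0 msupp0.
  by rewrite mulr1 => /hg.
- move=> i ip; rewrite !mxE /=; have [->|ij] := eqVneq i j.
    by rewrite ew mulr1 opprB addrCA subrr addr0 subrr.
  have lt : (i < n - p.+1)%N.
    by move: ij; rewrite -val_eqE /= => /eqP; move: ip pn; lia.
  by rewrite mulr0 v0 // w0 // !subr0.
exists (fun x => e x + (if x.1 == j then g@_x.2 else 0)).
have -> : lincomb kC (free_index (std_parts N c)) free_monomial
    (fun x => e x + (if x.1 == j then g@_x.2 else 0)) =
    lincomb kC (free_index (std_parts N c)) free_monomial e + g *: delta_mx 0 j.
  apply/rowP => i; rewrite [RHS]mxE !lincomb_free !mxE /=.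
  under eq_bigr do rewrite scalerDl; rewrite big_split; congr (_ + _) => /=.
  have [->|ij] := eqVneq i j; last by rewrite mulr0 big1 // => u _; rewrite scale0r.
  rewrite mulr1 -mpolyE_sub // => u ug.
  by rewrite mem_std_parts sg //=; apply/eqP/hg.
have := submoduleD hN he nw; congr N.
by rewrite [v - w - _]addrAC [_ - w - _]addrAC subrK opprD addrA [RHS]addrAC.
Qed.

End Shifts.

End GradedSubmodules.

(** * The Euler characteristic of a resolution *)

Section Resolution.

Variables (k : fieldType) (m d : nat) (a : 'I_m -> 'rV[int]_d).
Variables (M : lmodType {mpoly k[m]}) (G : grading a M) (F : free_resolution G).
Variable l : 'rV[int]_d.
Hypothesis a_gt0 : forall i, 0 < dot (a i) l.
Local Notation R := {mpoly k[m]}.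
Local Notation kC := (@mpolyC m k : {rmorphism k -> R}).
Local Notation shift i := (@res_shift _ _ _ _ _ _ F i).
Local Notation free i c := (free_homog (k := k) a (shift i) c).

Definition res_image i : 'rV[R]_(res_rank F i) -> Prop :=
  fun v => exists w, res_diff F i w = v.

Lemma submodule_res_image i : submodule (@res_image i).
Proof.
split; first by exists 0; rewrite raddf0.
by move=> c _ _ [v <-] [w <-]; exists (c *: v + w); rewrite linearP.
Qed.

Lemma hfilt_predT n (b : 'I_n -> 'rV[int]_d) (v : 'rV[R]_n) : hfilt a b predT v = v.
Proof. by apply/rowP => j; rewrite mxE filt_id. Qed.

Lemma hfilt_res_diff i Q w :
  hfilt a (shift i) Q (res_diff F i w) = res_diff F i (hfilt a (shift i.+1) Q w).
Proof.
have [s [us hs]] := hfilt_decomposition a (shift i.+1) w.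
rewrite -{1}(hfilt_predT (shift i.+1) w) !hs !raddf_sum [RHS]big_mkcond /=.
apply: eq_bigr => c _.
by rewrite (hfilt_homog _ (res_diff_homog (@free_homog_hfilt _ _ _ _ _ _ _ _))).
Qed.

Lemma hgraded_res_image i : hgraded a (shift i) (@res_image i).
Proof. by move=> Q _ [w <-]; exists (hfilt a (shift i.+1) Q w); rewrite hfilt_res_diff. Qed.

(** For the zero submodule the coordinate ideals vanish, so every monomial is standard. *)
Lemma qdim_free n (b : 'I_n -> 'rV[int]_d) c :
  qdim kC (free_homog a b c) (fun v : 'rV[R]_n => v = 0)
    (\sum_j vpf a l setT (c - b j))%N.
Proof.
have S0 : submodule (fun v : 'rV[R]_n => v = 0).
  by split=> // x v w -> ->; rewrite scaler0 addr0.
have g0 : hgraded a b (fun v : 'rV[R]_n => v = 0).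
  by move=> Q v ->; rewrite raddf0.
have := qdim_std a_gt0 c S0 g0; congr qdim; apply: eq_bigr => j _.
rewrite -[RHS]count_predT; apply: eq_count => u; apply/stdP => -[g [[v [-> _ <-]]]].
by rewrite mxE eqxx.
Qed.

(* The differential identifies [F_(i+1) / im d_(i+1)] with [im d_i]. *)
Lemma qdim_res_image i c q : qdim kC (free i.+1 c) (@res_image i.+1) q ->
  qdim kC (fun v => free i c v /\ res_image v) (fun v => v = 0) q.
Proof.
move=> [I [s [e [us sz he hi hs]]]]; exists I, s, (fun x => res_diff F i (e x)).
have lE x : lincomb kC s (fun x => res_diff F i (e x)) x =
    res_diff F i (lincomb kC s e x).
  by rewrite raddf_sum; apply: eq_bigr => y _ /=; rewrite linearZ.
split=> //.
- by move=> x xs; split; [apply: res_diff_homog; apply: he | exists (e x)].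
- by move=> x; rewrite lE => /res_exact /hi.
- move=> v [hv [w ew]]; have [|x [w' ew']] := hs (hfilt a (shift i.+1) (pred1 c) w).
    exact: free_homog_hfilt.
  exists x; rewrite lE -{1}[v](_ : hfilt a (shift i) (pred1 c) v = v); last first.
    by rewrite (hfilt_homog _ hv) /= eqxx.
  by rewrite -ew hfilt_res_diff -raddfB /= -ew'; apply/res_exact; exists w'.
Qed.

(** Dimensions add up along 0, im d_i, F_i in degree [c], where im d_i is F_(i+1) modulo im
    d_(i+1). *)
Lemma euler_step i c q q' : qdim kC (free i c) (@res_image i) q ->
  qdim kC (free i.+1 c) (@res_image i.+1) q' ->
  (\sum_j vpf a l setT (c - shift i j) = q + q')%N.
Proof.
move=> hq /qdim_res_image hq'.
have k0 : ksubspace kC (fun v : 'rV[R]_(res_rank F i) => v = 0).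
  by split=> // x v w -> ->; rewrite scaler0 addr0.
have kA := @ksubspace_free_homog k m d a _ (shift i) c.
have kB : ksubspace kC (fun v => free i c v /\ res_image v).
  have kI := ksubspace_submodule (@submodule_res_image i).
  split; first by split; [case: kA | case: kI].
  by move=> x v w [v1 v2] [w1 w2]; case: kA kI => _ hA [_ hI]; split; [exact: hA | exact: hI].
apply: (qdim_unique k0 (qdim_free (shift i) c)).
apply: (qdimD kA kB k0 _ _ _ hq') => [v ->|v []//|]; first by case: kB.
case: hq => I [s [e [us sz he hi hs]]]; exists I, s, e; split=> //.
  by move=> x [_ hx]; apply: hi.
move=> v hv; have [x hx] := hs v hv; exists x; split=> //.
exact: (ksubspaceB kA hv (ksubspace_lincomb x kA he)).
Qed.

(** The dimension in degree [c] of F_i modulo im d_i; for [i = 0], the Hilbert function of [M]. *)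
Definition std_count i c : nat :=
  (\sum_j count (std (coord_ideal (@res_image i) j)) (parts a l setT (c - shift i j)))%N.

Lemma qdim_std_count i c : qdim kC (free i c) (@res_image i) (std_count i c).
Proof. exact: qdim_std (submodule_res_image _) (@hgraded_res_image _). Qed.

(** By [euler_step] the alternating sum telescopes. *)
Lemma hilbert_Kpoly c : hilbert a l (Kpoly F) c = std_count 0 c.
Proof.
have fE i : (\sum_j vpf a l setT (c - shift i j) = std_count i c + std_count i.+1 c)%N.
  exact: euler_step (qdim_std_count _ _) (qdim_std_count _ _).
suff -> : hilbert a l (Kpoly F) c = (std_count 0 c)%:Z +
    (-1) ^+ (res_len F) * (std_count (res_len F).+1 c)%:Z.
  suff -> : std_count (res_len F).+1 c = 0%N by rewrite mulr0 addr0.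
  (* Beyond [res_len] the ranks are 0, so the left side of [fE] is an empty sum and both of its
     counts vanish. *)
  have := fE (res_len F).+1; rewrite big1 => [/esym/eqP|j _].
    by rewrite addn_eq0 => /andP [/eqP].
  by have := ltn_ord j; rewrite [X in (_ < X)%N]res_finite.
rewrite /hilbert raddf_sum /=.
transitivity (\sum_(i < (res_len F).+1)
    (-1) ^+ i * ((std_count i c)%:Z + (std_count i.+1 c)%:Z)).
  apply: eq_bigr => i _; rewrite raddf_sum -PoszD -fE /=.
  rewrite -[X in _ * X]natz natr_sum mulr_sumr; apply: eq_bigr => j _.
  by rewrite lin_extU natz.
elim: (res_len F) => [|n IH]; first by rewrite big_ord_recr big_ord0 /= expr0 !mul1r add0r.
by rewrite big_ord_recr IH /= exprS; ring.
Qed.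

Lemma annihilates_coord_ideal f j : annihilates M f -> coord_ideal (@res_image 0) j f.
Proof.
move=> hf; exists (f *: delta_mx 0 j); split.
- by apply/res_exact0; rewrite linearZ /= hf.
- move=> i ij; rewrite mxE [delta_mx _ _ _ _]mxE /=.
  by case: (i =P j) => [e|_]; [rewrite e ltnn in ij | rewrite mulr0].
- by rewrite !mxE !eqxx mulr1.
Qed.

(* A product of elements of all the coordinate ideals annihilates [M]. *)
Lemma prime_coord_ideal (P : R -> Prop) : prime_ideal P ->
  (forall f, annihilates M f -> P f) ->
  exists j, forall f, coord_ideal (@res_image 0) j f -> P f.
Proof.
move=> [hP P1 primeP] annP; apply: NNPP => hn; apply: P1.
have {}hn (j : 'I_(res_rank F 0)) : exists g, coord_ideal (@res_image 0) j g /\ ~ P g.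
  apply: NNPP => hj; apply: hn; exists j => f If; apply: NNPP => Pf.
  by apply: hj; exists f.
apply: NNPP => P1.
have N0 := submodule_res_image 0; set n := res_rank F 0 in hn.
suff [h [Ph hN]] : exists h, ~ P h /\ forall v, res_image (h *: v : 'rV_n).
  apply: Ph; apply: annP => x; have [v <-] := res_aug_surj F x.
  by rewrite -linearZ; apply/res_exact0; apply: hN.
suff key p : (p <= n)%N -> exists h, ~ P h /\ forall v : 'rV[R]_n,
    (forall i : 'I_n, (i < n - p)%N -> v 0 i = 0) -> res_image (h *: v : 'rV_n).
  have [h [Ph hN]] := key n (leqnn n); exists h; split=> // v.
  by apply: hN => i; rewrite subnn.
elim: p => [|p IH] pn.
  exists 1; split=> // v hv; rewrite (_ : v = 0) ?scaler0; first by case: N0.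
  by apply/rowP => i; rewrite hv ?mxE // subn0.
have [h [Ph hN]] := IH (ltnW pn).
have jn : (n - p.+1 < n)%N by lia.
pose j := Ordinal jn.
have [g [[w [nw w0 wj]] Pg]] := hn j.
exists (h * g); split; first by case/primeP.
(* As [w 0 j = g], subtracting [v 0 j *: w] from [g *: v] clears coordinate [j] as well, and [h]
   applies. *)
move=> v v0; rewrite -scalerA -(subrK (v 0 j *: w) (g *: v)) scalerDr.
apply: submoduleD => //; last by do 2! apply: submoduleZ => //.
apply: hN => i ip; rewrite !mxE.
have [->|ij] := eqVneq i j; first by rewrite wj mulrC subrr.
have lt : (i < n - p.+1)%N.
  by move: ij; rewrite -val_eqE /= => /eqP; move: ip pn; lia.
by rewrite (v0 i) // (w0 i) // !mulr0 subrr.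
Qed.

End Resolution.

(** * The multidegree *)

Lemma meval_ordinary_weight d (b l : 'rV[int]_d) :
  (ordinary_weight b).@[fun j => l 0 j] = dot b l.
Proof.
rewrite /ordinary_weight raddf_sum; apply: eq_bigr => j _ /=.
by rewrite mevalZ mevalXU.
Qed.

Lemma prime_ideal_of_pred (k : fieldType) m (P : {pred {mpoly k[m]}}) :
  idealr_closed P -> prime_idealr_closed P -> prime_ideal (fun f => f \in P).
Proof.
move=> [P0 P1 hP] primeP; split; first by split=> // c f g; apply: hP.
  exact/negP.
by move=> f g /primeP /orP.
Qed.

Lemma pred_of_prime_ideal (k : fieldType) m (P : {mpoly k[m]} -> Prop) :
  prime_ideal P -> idealr_closed [pred f | classically_b (P f)] /\
    prime_idealr_closed [pred f | classically_b (P f)].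
Proof.
move=> [[P0 hP] P1 primeP]; split; first split.
- exact/classically_bP.
- by apply/negP => /classically_bP.
- move=> c f g /classically_bP hf /classically_bP hg.
  by apply/classically_bP; apply: hP.
move=> f g /classically_bP /primeP [h|h]; apply/orP; [left|right];
  exact/classically_bP.
Qed.

Section Multidegree.

Variables (k : fieldType) (m d : nat) (a : 'I_m -> 'rV[int]_d).
Variables (M : lmodType {mpoly k[m]}) (G : grading a M) (F : free_resolution G).
Variable l : 'rV[int]_d.
Hypothesis a_gt0 : forall i, 0 < dot (a i) l.

Local Notation I_ j := (coord_ideal (@res_image k m d a M G F 0) j).

Lemma wgraded_coord_ideal j : wgraded (k := k) (height a l) (I_ j).
Proof.
move=> Q f hf.
have := graded_coord_ideal (fun b => Q `|dot b l|%N) (@hgraded_res_image _ _ _ _ _ _ F 0) hf.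
by rewrite (eq_filt _ (Q' := fun u => Q (wt (height a l) u))) // => u; rewrite dot_wdeg.
Qed.

(** By [hilbert_inj] it is enough to compare Hilbert functions, and both sides count standard
    monomials. *)
Lemma Kpoly_boxes : exists L : forall j : 'I_(res_rank F 0), seq ('X_{1..m} * {set 'I_m}),
  (forall j u, count (fun x => box x.1 x.2 u) (L j) = std (I_ j) u) /\
  Kpoly F = \sum_j \sum_(x <- L j)
    box_K a (res_shift j + wdeg a x.1) (enum (~: x.2)).
Proof.
have idI j := ideal_coord_ideal j (submodule_res_image F 0).
have [L hL] := fin_all_exists (fun j => stanley_decomposition (std_down_closed (idI j))).
exists L; split=> //; apply: (hilbert_inj a_gt0) => c.
rewrite hilbert_Kpoly // /std_count /hilbert !raddf_sum; apply: eq_bigr => j _ /=.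
rewrite (count_parts a_gt0 _ (hL j)) !raddf_sum; apply: eq_bigr => x _ /=.
rewrite -/(hilbert a l _ c) hilbert_box_K ?enum_uniq // opprD addrA.
by congr (Posz (vpf _ _ _ _)); apply/setP => i; rewrite !inE mem_enum !inE negbK.
Qed.

(** A box yields a chain of primes as long as its number of directions. Conversely the least prime
    of a longest chain contains some coordinate ideal, whose boxes cannot all have fewer than [n]
    directions by growth. *)
Lemma boxes_dim (L : forall j : 'I_(res_rank F 0), seq ('X_{1..m} * {set 'I_m})) n :
  module_dim M n ->
  (forall j u, count (fun x => box x.1 x.2 u) (L j) = std (I_ j) u) ->
  (forall j x, x \in L j -> #|x.2| <= n)%N /\
  exists j x, x \in L j /\ #|x.2| = n.
Proof.
move=> [[P [prP chP]] Pmax] hL.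
have idI j := ideal_coord_ideal j (submodule_res_image F 0).
have small j x : x \in L j -> (#|x.2| <= n)%N.
  move=> xL; have tI : trivial_cap (I_ j) x.2.
    by apply: (trivial_cap_of_box (v := x.1)) => // u; apply: box_sub_of_count (hL j) xL.
  have [P' [prP' chP'] IP'] :=
    exists_chain_trivial_cap (height_gt0 a_gt0) (idI j) (@wgraded_coord_ideal j) tI.
  apply: (Pmax _ (fun i => [pred f | classically_b (P' i f)])); split=> [i|i1 i2 lt].
    have [h1 h2] := pred_of_prime_ideal (prP' i); split=> // f hf.
    by apply/classically_bP; apply: IP'; apply: annihilates_coord_ideal.
  have [h1 h2] := chP' _ _ lt; split=> [f /classically_bP h|h].
    by apply/classically_bP; apply: h1.
  by apply: h2 => f hf; apply/classically_bP; apply: h; apply/classically_bP.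
split=> //.
pose P' i f := f \in P i.
have prP' i : prime_ideal (P' i) by have [h1 h2 _] := prP i; apply: prime_ideal_of_pred.
have [||j IP] := @prime_coord_ideal _ _ _ _ _ _ F (P' ord0) => //.
  by move=> f; have [_ _] := prP ord0; apply.
have chP' : strict_chain P' by [].
apply: NNPP => hn.
have smaller x : x \in L j -> (#|x.2| <= n.-1)%N.
  move=> xL; have := small j x xL; rewrite leq_eqVlt => /orP [/eqP e|]; last by case: (n).
  by case: hn; exists j, x.
have := leq_chain_std (height_gt0 a_gt0) chP' IP (idI j) (@wgraded_coord_ideal j)
  (hL j) smaller.
(* For [n = 0] the bound [n.-1] gives no contradiction; there, any box will do, and one exists
   because without standard monomials 1 would lie in the coordinate ideal, hence in a prime. *)
case: n {small Pmax} P prP chP P' prP' IP chP' hn smaller => [|n] P _ _ P' prP' IP _ hn smaller;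
  last by rewrite ltnn.
move=> _; case eL: (L j) => [|x s].
  have [g Ig sg] := ideal_division 1 (idI j).
  have g0 : g = 0.
    apply/eqP; apply: contraT => g0.
    by have := hL j (mlead g); rewrite eL (sg _ (mlead_supp g0)).
  by have [_ []] := prP' ord0; apply: IP; rewrite -[1]subr0 -g0.
have xL : x \in L j by rewrite eL mem_head.
by apply: hn; exists j, x; split=> //; apply/eqP; rewrite -leqn0 smaller.
Qed.

End Multidegree.

Theorem theorem4 (k : fieldType) (m d r : nat) (a : 'I_m -> 'rV[int]_d)
    (hpos : positively_graded k a) (hr : (r <= m)%N)
    (M : lmodType {mpoly k[m]}) (G : grading a M)
    (hfg : finitely_generated M) (hdim : module_dim M (m - r))
    (F : free_resolution G) :
  exists c : {set 'I_m} -> nat,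
    multidegree F =
      \sum_(I : {set 'I_m} | #|I| == r)
        (\prod_(i in I) ordinary_weight (a i)) *+ c I
    /\ multidegree F <> 0.
Proof.
have [l a_gt0] := positive_half_space hpos.
have [L [hL KE]] := Kpoly_boxes F a_gt0.
have [Lle [j0 [x0 [x0L x0dim]]]] := boxes_dim a_gt0 hdim hL.
pose T := [seq (res_shift j + wdeg a x.1, ~: x.2) |
  j <- enum 'I_(res_rank F 0), x <- L j].
pose c (I : {set 'I_m}) := count (fun y => y.2 == I) T.
pose W (I : {set 'I_m}) := \prod_(i in I) ordinary_weight (a i).
have Tge y : y \in T -> (r <= #|y.2|)%N.
  move=> /allpairsPdep [j [x [_ /Lle le ->]]] /=.
  by move: le; rewrite (cardsCs x.2) card_ord leq_sub2lE.
have {}KE : Kpoly F = \sum_(y <- T) box_K a y.1 (enum y.2).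
  by rewrite KE /T big_allpairs_dep big_enum.
pose P := \sum_(y <- T) (if #|y.2| == r then W y.2 else 0).
(* A box missing more than [r] directions only starts above degree [r]; one missing exactly [r]
   contributes its product of weights. *)
have lowP : lowest (Kpoly F) r P.
  rewrite KE /P !big_seq; elim/big_rec2: _ => [|y K' P' /Tge le h].
    exact: lowest0.
  apply: lowestD h; have := lowest_box_K a y.1 (enum y.2).
  rewrite -cardE big_enum; case: eqP => [->//|ne].
  by apply: lowestW; rewrite ltn_neqAle le andbT; apply/eqP/nesym.
have PE : P = \sum_(I : {set 'I_m} | #|I| == r) W I *+ c I.
  rewrite /P /c; elim: T {Tge KE P lowP c} => [|y T IH].
    by rewrite big_nil big1.
  rewrite big_cons IH /=; under [RHS]eq_bigr do rewrite mulrnDr.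
  rewrite big_split; congr (_ + _) => /=.
  case: ifP => [yr|/negbT yr].
    rewrite (bigD1 y.2) //= eqxx mulr1n big1 ?addr0 // => I /andP [_ /negbTE ne].
    by rewrite eq_sym ne.
  by rewrite big1 // => I /eqP Ir; case: eqP => // e; rewrite e Ir eqxx in yr.
(* Evaluation at [l] makes every [W I] positive, so nothing cancels, and the box [x0] with [m - r]
   directions contributes a term. *)
have P0 : P != 0.
  apply/negP => /eqP /(congr1 (meval (fun j => l 0 j))) /eqP; rewrite meval0 /P raddf_sum /=.
  have Wpos I : 0 < (W I).@[fun j => l 0 j].
    rewrite /W rmorph_prod /= prodr_gt0 // => i _.
    by rewrite meval_ordinary_weight.
  rewrite psumr_eq0 => [/allP h|y _]; last by case: ifP => _; rewrite ?meval0 // ltW.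
  have yT : (res_shift j0 + wdeg a x0.1, ~: x0.2) \in T.
    by apply/allpairsPdep; exists j0, x0; rewrite mem_enum.
  have le : (#|~: x0.2| <= m)%N by rewrite -[X in (_ <= X)%N](card_ord m) max_card.
  have e : #|~: x0.2| == r.
    by move: x0dim; rewrite (cardsCs x0.2) card_ord => /eqP; rewrite eqn_sub2lE.
  by have := h _ yT; rewrite /= e gt_eqF.
exists c; rewrite /multidegree (lowest_partE lowP P0); split; first exact: PE.
exact/eqP.
Qed.
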